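(* Let $1<q<p<\infty$ and $\alpha,\beta>0$ with $\frac{\alpha}{p}+\frac{\beta}{q}=1$; set $s=\alpha+\beta$. Let $a<b$, let $\lambda_1(p,q)$ be the first Dirichlet eigenvalue on $(a,b)$ of the system $$-(|u'|^{p-2}u')'=\lambda\alpha|u|^{\alpha-2}u|v|^\beta,\qquad -(|v'|^{q-2}v')'=\lambda\beta|u|^\alpha|v|^{\beta-2}v,$$ with $u(a)=u(b)=v(a)=v(b)=0$, and let $\Lambda_1(s)$ be the first Dirichlet eigenvalue of $-(|\varphi'|^{s-2}\varphi')'=\Lambda|\varphi|^{s-2}\varphi$ on $(a,b)$. Then $$\lambda_1(p,q)\le\Lambda_1(s)\left[\frac1p+\frac1q\left(\frac{\pi_s}{(s-1)\int_0^{\pi_s}\sin_s^s(t)\,dt}\right)^{1-\frac{q}{s}}\right].$$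
   Context: $\lambda_1(p,q)$ is the infimum over $(u,v)\in W^{1,p}_0(a,b)\times W^{1,q}_0(a,b)$ with $\int_a^b|u|^\alpha|v|^\beta>0$ of $\big(\frac1p\int_a^b|u'|^p+\frac1q\int_a^b|v'|^q\big)/\int_a^b|u|^\alpha|v|^\beta$; $\Lambda_1(s)=\inf\{\int_a^b|u'|^s/\int_a^b|u|^s: 0\ne u\in W^{1,s}_0(a,b)\}$. For $s>1$, $\pi_s=2\int_0^1\frac{dt}{(1-t^s)^{1/s}}$, and $\sin_s$ is the solution of $-(|u'|^{s-2}u')'=(s-1)|u|^{s-2}u$, $u(0)=0$, $u'(0)=1$; on $[0,\pi_s/2]$ it is given implicitly by $x=\int_0^{\sin_s(x)}\frac{dt}{(1-t^s)^{1/s}}$, and its first positive zero is $\pi_s$. *)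

(* Defs.v *)
From HB Require Import structures.
From mathcomp Require Import all_boot all_order all_algebra.
From mathcomp Require Import all_classical all_reals all_analysis.
Set Implicit Arguments. Unset Strict Implicit. Unset Printing Implicit Defensive.
Import Order.TTheory GRing.Theory Num.Theory.
Local Open Scope classical_set_scope.
Local Open Scope ring_scope.

Section Defs.
Variable R : realType.
Notation mu := (@lebesgue_measure R).

(* [W10 p a b u g] : u belongs to W^{1,p}_0(a,b) with weak derivative g.
   One-dimensional description of W^{1,p}_0(a,b): (the continuous
   representative of) u is u(x) = \int_a^x g with g in L^p(a,b), and
   u(a) = u(b) = 0 (u(a) = 0 is automatic). *)
Definition W10 (p a b : R) (u g : R -> R) : Prop :=
  [/\ measurable_fun `[a, b] g,
      mu.-integrable `[a, b] (fun x => (`|g x| `^ p)%:E),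
      (forall x, a <= x <= b -> u x = Rintegral mu `[a, x] g)
    & u b = 0].

Definition lambda1 (p q alpha beta a b : R) : R :=
  inf [set r | exists u du v dv, [/\ W10 p a b u du, W10 q a b v dv,
        0 < Rintegral mu `[a, b] (fun x => `|u x| `^ alpha * `|v x| `^ beta)
      & r = (p^-1 * Rintegral mu `[a, b] (fun x => `|du x| `^ p)
             + q^-1 * Rintegral mu `[a, b] (fun x => `|dv x| `^ q))
            / Rintegral mu `[a, b] (fun x => `|u x| `^ alpha * `|v x| `^ beta)]].

Definition Lambda1 (s a b : R) : R :=
  inf [set r | exists u du, [/\ W10 s a b u du,
        Rintegral mu `[a, b] (fun x => `|u x| `^ s) != 0
      & r = Rintegral mu `[a, b] (fun x => `|du x| `^ s)
            / Rintegral mu `[a, b] (fun x => `|u x| `^ s)]].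

Definition Fs (s y : R) : R :=
  Rintegral mu `[0, y] (fun t => (1 - t `^ s) `^ (- s^-1)).

Definition pis (s : R) : R := 2 * Fs s 1.

(* sin_s on [0, pi_s/2]: the y in [0,1] with x = F_s(y) (F_s is increasing) *)
Definition sins_half (s x : R) : R := sup [set y | 0 <= y <= 1 /\ Fs s y <= x].

(* sin_s on [0, pi_s], using the symmetry sin_s(pi_s - x) = sin_s(x) *)
Definition sins (s x : R) : R :=
  if x <= pis s / 2 then sins_half s x else sins_half s (pis s - x).

End Defs.

(* Main.v *)
Require Import Defs.
From HB Require Import structures.
From mathcomp Require Import all_boot all_order all_algebra.
From mathcomp Require Import all_classical all_reals all_analysis.
From mathcomp Require Import measurable_realfun ring lra.
Import Order.TTheory GRing.Theory Num.Theory.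
Import numFieldNormedType.Exports.
Local Open Scope classical_set_scope.
Local Open Scope ring_scope.

(** Put k = pi_s / (b - a), S = sin_s and C = S', so that C^s + S^s = 1.

    Upper bound for lambda_1: test with u = v = S(k(x - a)) / k.  Then |u'| <= 1,
    hence int |u'|^p <= int |u'|^s since p > s, while Jensen's inequality bounds
    int |u'|^q by a power of int |u'|^s since q < s.  The integrals are explicit
    because S^s and C^s have the antiderivatives (x - S C^(s-1)) / s and
    ((s-1) x + S C^(s-1)) / s.

    Lower bound Lambda_1(s) >= (s-1) k^s: on the half interval starting at a,
    Hoelder's inequality with weight C gives
    |u(x)|^s <= S(x)^(s-1) int_a^x |u'|^s C^(1-s) (for k = 1), and integrating in
    x with Tonelli produces the factor int_t S^(s-1) = C(t)^(s-1) / (s-1), which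
    cancels the weight.  No chain rule for |u|^s is needed. *)

(** Since q < p and alpha/p + beta/q = 1, the exponent [s] lies strictly between [q] and [p]; taking
    u = v turns the coupling integral into int |u|^s. The trial quotient is then at most (s-1) k^s
    [1/p + (1/q) (s/(s-1))^(1-q/s)], and this bracket is the one in the theorem because int_0^(pi_s)
    sin_s^s = pi_s / s. The two eigenvalue bounds meet at (s-1) k^s. The obstacle is that
    [sins_half] is only a supremum. Its calculus is recovered from [Fs]: the integrand is at least 1
    on [0, 1), so [Fs] is expanding and its inverse is 1-Lipschitz. The integrand is singular at 1
    and C vanishes at the midpoint, so derivatives are taken on open intervals only, with continuity
    up to the endpoints proved separately. *)

Section powR_facts.
Set Implicit Arguments.
Unset Strict Implicit.
Context {R : realType}.

Lemma continuous_powR_norm (r : R) : 0 < r ->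
  continuous (fun y : R => `|y| `^ r).
Proof.
move=> r0 y; have [->|y0] := eqVneq y 0.
- rewrite /continuous_at normr0 powR0 ?gt_eqF//.
  apply/cvgrPdist_lt => e e0; near=> z.
  rewrite sub0r normrN ger0_norm ?powR_ge0//.
  (* Monotonicity of the power reduces the claim to |z| < e^(1/r). *)
  have -> : e = (e `^ r^-1) `^ r.
    by rewrite -powRrM mulVf ?gt_eqF// powRr1// ltW.
  rewrite gt0_ltr_powR// ?nnegrE ?powR_ge0//.
  near: z; apply: (@nbhs0_lt R R); exact: powR_gt0.
- apply: (@continuous_comp _ _ _ (fun z : R => `|z|) (fun z : R => z `^ r)).
    exact: norm_continuous.
  apply: differentiable_continuous; apply/derivable1_diffP.
  by apply: derivable_powR; rewrite in_itv/= andbT normr_gt0.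
Unshelve. all: by end_near. Qed.

(** Convexity of y^s: its graph lies above the tangent at [m]. This is Young's inequality for y and
    m^(s-1) with conjugate exponents s and s/(s-1). *)
Lemma powR_tangent (s y m : R) : 1 < s -> 0 <= y -> 0 <= m ->
  s * m `^ (s - 1) * y <= y `^ s + (s - 1) * m `^ s.
Proof.
move=> s1 y0 m0; have s0 : 0 < s by lra.
have s10 : 0 < s - 1 by lra.
have := @conjugate_powR R y (m `^ (s - 1)) s (s / (s - 1)) y0 (powR_ge0 _ _) s0.
rewrite -powRrM (mulrC (s - 1)) divfK ?gt_eqF// divr_gt0// invf_div => /(_ isT).
have -> : s^-1 + (s - 1) / s = 1 by field; rewrite gt_eqF.
move=> /(_ erefl) H.
have -> : y `^ s + (s - 1) * m `^ s =
   s * (y `^ s / s + m `^ s * ((s - 1) / s)) by field; rewrite gt_eqF.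
by rewrite -mulrA ler_pM2l// mulrC.
Qed.

End powR_facts.

(** * Jensen's inequality with a weight *)

Section weighted_jensen.
Set Implicit Arguments.
Unset Strict Implicit.
Context d {T : measurableType d} {R : realType}.
Variable mu : {measure set T -> \bar R}.

(** Jensen for f/c against the measure c dmu of mass [sg], obtained by integrating a tangent
    inequality. Taking [w] as a mere lower bound of int f allows w = |u(x)|, and extended reals let
    the right-hand integral be infinite. *)
Lemma weighted_jensen (D : set T) (f c : T -> R) (s w sg : R) :
  measurable D -> measurable_fun D f -> measurable_fun D c ->
  (forall x, D x -> 0 <= f x) -> (forall x, D x -> 0 < c x) ->
  1 < s -> 0 <= w -> 0 < sg ->
  (\int[mu]_(x in D) (c x)%:E = sg%:E)%E ->
  (w%:E <= \int[mu]_(x in D) (f x)%:E)%E ->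
  ((w `^ s)%:E <= (sg `^ (s - 1))%:E *
     \int[mu]_(x in D) (f x `^ s * c x `^ (1 - s))%:E)%E.
Proof.
move=> mD mf mc f0 c0 s1 w0 sg0 ic wf.
have s0 : 0 < s by lra.
have s10 : 0 < s - 1 by lra.
have c0' x : D x -> 0 <= c x by move=> /c0/ltW.
(* When [w] equals int f, this is the mean of f/c, the contact point for which the integrated
   tangent inequality gives Jensen's constant. *)
pose m := w / sg; have m0 : 0 <= m by rewrite divr_ge0// ltW.
have mp (g : T -> R) r : measurable_fun D g -> measurable_fun D (fun x => g x `^ r).
  by move=> mg; exact: (measurableT_comp (@measurable_powR R r)).
have mI : measurable_fun D (fun x => f x `^ s * c x `^ (1 - s)).
  by apply: measurable_funM; exact: mp.
have I0 x : D x -> (0 <= (f x `^ s * c x `^ (1 - s))%:E)%E.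
  by move=> _; rewrite lee_fin mulr_ge0// powR_ge0.
have : (\int[mu]_(x in D) ((s * m `^ (s - 1))%:E * (f x)%:E) <=
  \int[mu]_(x in D) ((f x `^ s * c x `^ (1 - s))%:E
     + ((s - 1) * m `^ s)%:E * (c x)%:E))%E.
  apply: ge0_le_integral => //.
  - by move=> x Dx; rewrite lee_fin mulr_ge0// ?f0// mulr_ge0 ?powR_ge0 ?ltW.
  - apply/measurable_EFinP; exact: measurable_funM.
  - apply/measurable_EFinP; apply: measurable_funD => //; exact: measurable_funM.
  - move=> x Dx; rewrite -!EFinM -EFinD lee_fin.
    have cx := c0 _ Dx.
    have fc0 : 0 <= f x / c x by rewrite divr_ge0 ?f0 ?c0'.
    have H0 := powR_tangent s1 fc0 m0.
    (* The tangent inequality is used at f/c and multiplied by c, with (f/c)^s c = f^s c^(1-s). *)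
    have -> : s * m `^ (s - 1) * f x = s * m `^ (s - 1) * (f x / c x) * c x.
      by field; rewrite gt_eqF.
    apply: (@le_trans _ _ (((f x / c x) `^ s + (s - 1) * m `^ s) * c x)).
      by rewrite ler_pM2r.
    rewrite mulrDl lerD2r.
    rewrite powRM ?f0 ?invr_ge0 ?c0'// -powR_inv1 ?c0'// -powRrM mulN1r -mulrA.
    by rewrite mulrC -{2}(powRr1 (c0' _ Dx)) -powRD ?(gt_eqF cx) ?implybT// mulrC addrC.
rewrite ge0_integralZl//; last 2 first.
- exact/measurable_EFinP.
- by rewrite lee_fin mulr_ge0 ?powR_ge0 ?ltW.
rewrite ge0_integralD//; last 3 first.
- exact/measurable_EFinP.
- by move=> x Dx; rewrite lee_fin mulr_ge0 ?c0'// mulr_ge0 ?powR_ge0 ?ltW.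
- by apply/measurable_EFinP; exact: measurable_funM.
rewrite ge0_integralZl//; last 2 first.
- exact/measurable_EFinP.
- by rewrite lee_fin mulr_ge0 ?powR_ge0 ?ltW.
rewrite ic => H.
have {H} : ((s * m `^ (s - 1))%:E * w%:E <=
   \int[mu]_(x in D) (f x `^ s * c x `^ (1 - s))%:E +
    ((s - 1) * m `^ s)%:E * sg%:E)%E.
  apply: le_trans H; apply: lee_wpmul2l => //.
  by rewrite lee_fin mulr_ge0 ?powR_ge0 ?ltW.
have J0 : (0 <= \int[mu]_(x in D) (f x `^ s * c x `^ (1 - s))%:E)%E.
  exact: integral_ge0.
case: (\int[mu]_(x in D) (f x `^ s * c x `^ (1 - s))%:E)%E J0 => [J| |]//; last first.
  by move=> _ _; rewrite gt0_muley ?leey// lte_fin powR_gt0.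
rewrite lee_fin => J0; rewrite -!EFinM -EFinD !lee_fin => H.
(* Both sides of [H] now contain m^(s-1) w, leaving m^(s-1) w <= J; multiplying by sg^(s-1) turns
   the left side into w^s. *)
have E1 : m `^ s * sg = m `^ (s - 1) * w.
  by rewrite -(mulr_powRB1 m0 s0) /m; field; rewrite gt_eqF.
have E2 : sg `^ (s - 1) * m `^ (s - 1) = w `^ (s - 1).
  by rewrite -powRM ?(ltW sg0)// /m mulrC divfK ?gt_eqF.
rewrite -(mulr_powRB1 w0 s0) -E2 mulrC -mulrA ler_pM2l ?powR_gt0//.
rewrite -(mulrA (s-1)) E1 in H; lra.
Qed.

End weighted_jensen.

(** * Schur's test by Tonelli *)

Section schur_test.
Set Implicit Arguments.
Unset Strict Implicit.
Context d {T : measurableType d} {R : realType}.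
Variable mu : {sigma_finite_measure set T -> \bar R}.

(* Schur's test with the kernel [e]: [c] is the Hoelder weight, [sg] its integral
   over the section at [x], and the third integral hypothesis says that
   integrating in [x] gives the weight back. *)
Lemma schur_test (D : set T) (e : set (T * T)) (u g c sg : T -> R) (s K : R) :
  measurable D -> measurable e ->
  measurable_fun D u -> measurable_fun D g -> measurable_fun D c ->
  measurable_fun D sg ->
  (forall x, D x -> 0 < c x) -> (forall x, D x -> 0 < sg x) ->
  1 < s -> 0 <= K ->
  (forall x, D x -> (`|u x|%:E <= \int[mu]_(t in D `&` xsection e x) `|g t|%:E)%E) ->
  (forall x, D x -> (\int[mu]_(t in D `&` xsection e x) (c t)%:E = (sg x)%:E)%E) ->
  (forall t, D t -> (\int[mu]_(x in D `&` ysection e t) (sg x `^ (s - 1))%:E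
     = (K * c t `^ (s - 1))%:E)%E) ->
  (\int[mu]_(x in D) (`|u x| `^ s)%:E <=
   K%:E * \int[mu]_(x in D) (`|g x| `^ s)%:E)%E.
Proof.
move=> mD me mu_ mg mc msg c0 sg0 s1 K0 H1 H2 H3.
have mp (E : set T) (f : T -> R) r :
    measurable_fun E f -> measurable_fun E (fun x => f x `^ r).
  by move=> mf; exact: (measurableT_comp (@measurable_powR R r)).
have mn (E : set T) (f : T -> R) :
    measurable_fun E f -> measurable_fun E (fun x => `|f x|).
  by move=> mf; exact: (measurableT_comp (@normr_measurable R setT)).
pose w' t := `|g t| `^ s * c t `^ (1 - s).
(* Extension by zero outside [D] makes the integrand of the double integral a function on the whole
   product, as Tonelli requires. *)
pose w := w' \_ D.
pose v := (fun x => sg x `^ (s - 1)) \_ D.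
have mw' : measurable_fun D w'.
  by apply: measurable_funM; apply: mp => //; exact: mn.
have mw : measurable_fun setT w by exact/(measurable_restrictT _ _).1.
have mv : measurable_fun setT v by apply/(measurable_restrictT _ _).1 => //; exact: mp.
have w0 t : 0 <= w t.
  by rewrite /w patchE; case: ifPn => // _; rewrite mulr_ge0// powR_ge0.
have v0 t : 0 <= v t by rewrite /v patchE; case: ifPn => // _; rewrite powR_ge0.
pose h (z : T * T) := (\1_e z * (v z.1 * w z.2))%:E.
have mh : measurable_fun setT h.
  apply/measurable_EFinP; apply: measurable_funM => //.
  by apply: measurable_funM; apply: measurableT_comp.
have h0 z : (0 <= h z)%E by rewrite lee_fin !mulr_ge0.
have mex x : measurable (xsection e x) by exact: measurable_xsection.
have mey x : measurable (ysection e x) by exact: measurable_ysection.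
have Exy x t : \1_e (x, t) = \1_(xsection e x) t :> R.
  by rewrite !indicE; congr (_%:R); congr nat_of_bool; apply/idP/idP; rewrite !inE /xsection/= ?inE.
have Eyx x t : \1_e (x, t) = \1_(ysection e t) x :> R.
  by rewrite !indicE; congr (_%:R); congr nat_of_bool; apply/idP/idP; rewrite !inE /ysection/= ?inE.
have hx x : (\int[mu]_t h (x, t) =
    (v x)%:E * \int[mu]_(t in D `&` xsection e x) (w' t)%:E)%E.
  rewrite [in RHS]integral_mkcond -ge0_integralZl//=.
  - apply: eq_integral => t _; rewrite /h Exy/= indicE patchE /w patchE in_setI.
    by case: (t \in D); case: (t \in xsection e x); rewrite /= ?mul1r ?mul0r ?mulr0 ?mule0 ?EFinM.
  - apply/(measurable_restrictT _ _).1; first exact: measurableI.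
    by apply/measurable_EFinP; apply: measurable_funS mw' => //; exact: subIsetl.
  - by move=> t _; apply: erestrict_ge0 => z _; rewrite lee_fin mulr_ge0// powR_ge0.
  - by rewrite lee_fin.
have hy t : (\int[mu]_x h (x, t) =
    (w t)%:E * \int[mu]_(x in D `&` ysection e t) (sg x `^ (s - 1))%:E)%E.
  rewrite [in RHS]integral_mkcond -ge0_integralZl//=.
  - apply: eq_integral => x _; rewrite /h Eyx/= indicE patchE /v patchE in_setI.
    by case: (x \in D); case: (x \in ysection e t);
      rewrite /= ?mul1r ?mul0r ?mulr0 ?mule0// mulrC EFinM.
  - apply/(measurable_restrictT _ _).1; first exact: measurableI.
    apply/measurable_EFinP; apply: mp.
    by apply: measurable_funS msg => //; exact: subIsetl.
  - by move=> x _; apply: erestrict_ge0 => z _; rewrite lee_fin powR_ge0.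
  - by rewrite lee_fin.
(* Weighted Jensen in each section bounds |u(x)|^s by the inner integral. *)
apply: (@le_trans _ _ (\int[mu]_x \int[mu]_t h (x, t))%E).
  rewrite (integral_mkcond D); apply: ge0_le_integral => //.
  - by move=> x _; apply: erestrict_ge0 => z _; rewrite lee_fin powR_ge0.
  - apply/(measurable_restrictT _ _).1 => //.
    by apply/measurable_EFinP; apply: mp; exact: mn.
  - exact: measurable_fun_fubini_tonelli_F.
  - move=> x _; rewrite patchE; case: ifPn => [/set_mem Dx|_]; last first.
      by apply: integral_ge0.
    rewrite hx /v patchE mem_set//.
    have sD : D `&` xsection e x `<=` D by exact: subIsetl.
    apply: (@weighted_jensen _ _ _ mu (D `&` xsection e x) (fun t => `|g t|)) => //.
    + exact: measurableI.
    + by apply: mn; exact: measurable_funS mg.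
    + exact: measurable_funS mc.
    + by move=> t /sD /c0.
    + exact: sg0.
    + exact: H2.
    + exact: H1.
rewrite fubini_tonelli//.
under eq_integral do rewrite hy.
rewrite -ge0_integralZl//; last first.
  by apply/measurable_EFinP; apply: mp; exact: mn.
rewrite (integral_mkcond D) le_eqVlt; apply/orP; left; apply/eqP.
apply: eq_integral => t _; rewrite /w !patchE; case: ifPn => [/set_mem Dt|_]; last first.
  by rewrite mul0e.
rewrite H3// -!EFinM /w'; congr EFin.
(* The Hoelder weight c^(1-s) meets the factor c^(s-1) produced by the integration in x, and they
   cancel. *)
rewrite mulrC -!mulrA; congr (_ * _); rewrite mulrCA -powRD; last first.
  by rewrite (gt_eqF (c0 _ Dt)) implybT.
by rewrite addrC subrKA subrr powRr0 mulr1.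
Qed.

End schur_test.

(** * Fundamental theorem after an affine substitution *)

Section affine_FTC.
Set Implicit Arguments.
Unset Strict Implicit.
Context {R : realType}.
Notation mu := (@lebesgue_measure R).

Lemma is_derive_affine (k l t : R) : is_derive t 1 (fun t => k * t + l) k.
Proof.
apply: (@is_derive_eq _ _ _ (k \*: (@id R) + cst l) t 1 _ (k *: (1 : R) + 0)).
by rewrite addr0 /GRing.scale/= mulr1.
Qed.

Lemma continuous_affine (k l : R) : continuous (fun t : R => k * t + l).
Proof.
move=> t; apply: differentiable_continuous; apply/derivable1_diffP.
by have [] := is_derive_affine k l t.
Qed.

(** Either sign of the slope is allowed: the left half of (a, b) uses k(x - a), the right half the
    reflected k(b - x). Differentiability is asked only inside []c, d[], since the derivative
    formulas for S and C^(s-1) are established only in ]0, h[. *)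
Lemma integral_affine_FTC2 (F f : R -> R) (c d k l x y : R) :
  (forall z, c < z < d -> is_derive z 1 F (f z)) ->
  {in `[c, d], continuous F} -> {in `[c, d], continuous f} ->
  k != 0 -> x <= y -> c <= k * x + l <= d -> c <= k * y + l <= d ->
  (\int[mu]_(t in `[x, y]) (f (k * t + l)%R)%:E =
   ((F (k * y + l) - F (k * x + l)) / k)%:E)%E.
Proof.
move=> dF cF cf k0; rewrite le_eqVlt => /predU1P[<- _ _|xy /andP[cx xd] /andP[cy yd]].
  by rewrite set_itv1 integral_set1 subrr mul0r.
have mid t : x < t < y -> c < k * t + l < d.
  move=> /andP[xt ty]; case: (ltrgt0P k) k0 => // k0 _.
  - have : k * x < k * t by rewrite ltr_pM2l.
    have : k * t < k * y by rewrite ltr_pM2l.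
    lra.
  - have : k * t < k * x by rewrite ltr_nM2l.
    have : k * y < k * t by rewrite ltr_nM2l.
    lra.
have mid' t : x <= t <= y -> c <= k * t + l <= d.
  move=> /andP[]; rewrite le_eqVlt => /predU1P[<- _|xt]; first by rewrite cx.
  rewrite le_eqVlt => /predU1P[->|ty]; first by rewrite cy.
  by have /mid/andP[/ltW-> /ltW->] : x < t < y by rewrite xt.
pose G t := F (k * t + l) * k^-1.
have cG : {in `[x, y], continuous G}.
  move=> t; rewrite in_itv/= => /mid' ht.
  apply: (@cvgM R); last exact: cvg_cst.
  apply: continuous_comp; first exact: continuous_affine.
  by apply: cF; rewrite in_itv.
have dG t : x < t < y -> is_derive t 1 G (f (k * t + l)).
  move=> /mid /dF dFt.
  have /= H := @is_derive1_comp R F (fun t => k * t + l) t _ _ dFt (is_derive_affine k l t).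
  have -> : G = k^-1 \*: (F \o (fun t => k * t + l)).
    by apply/funext => z; rewrite /G mulrC.
  by apply: is_derive_eq (is_deriveZ _ H) _; rewrite /GRing.scale/= mulrC mulfK.
have wG : {within `[x, y], continuous G} by apply: continuous_in_subspaceT => t /[!inE]; exact: cG.
rewrite (@continuous_FTC2 _ _ G)//.
- by rewrite -EFinB /G mulrBl.
- apply: continuous_in_subspaceT => t; rewrite inE/= in_itv/= => /mid' ht.
  apply: continuous_comp; first exact: continuous_affine.
  by apply: cf; rewrite in_itv.
- move: wG => /(continuous_within_itvP _ xy)[_ G1 G2].
  split => // t; rewrite in_itv/= => /dG[]//.
- by move=> t; rewrite in_itv/= => /dG dGt; rewrite derive1E; exact: derive_val.
Qed.

End affine_FTC.

(** * Integrability of (1 - t^s)^(-1/s) on [0, 1] *)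

Section arcsine_integral.
Set Implicit Arguments.
Unset Strict Implicit.
Context {R : realType}.
Notation mu := (@lebesgue_measure R).
Variable s : R.
Hypothesis s1 : 1 < s.

Let s0 : 0 < s. Proof. exact: lt_trans s1. Qed.
Let sV0 : 0 < s^-1. Proof. by rewrite invr_gt0. Qed.
Let sV1 : s^-1 < 1. Proof. by rewrite invf_lt1. Qed.

Let one_powR r : 1 `^ r = 1 :> R. Proof. by rewrite powR1. Qed.

Let f (t : R) := (1 - t `^ s) `^ (- s^-1).

Lemma measurable_arcsine_integrand D : measurable_fun D f.
Proof.
apply: measurable_funTS.
apply: (measurableT_comp (@measurable_powR R (- s^-1))).
by apply: measurable_funB.
Qed.

Lemma powR_lt1 (t : R) : 0 <= t < 1 -> t `^ s < 1.
Proof. by move=> /andP[t0 t1]; rewrite -[ltRHS](one_powR s) gt0_ltr_powR// nnegrE. Qed.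

Lemma arcsine_integrand_ge1 (t : R) : 0 <= t < 1 -> 1 <= f t.
Proof.
move=> t01; have := powR_lt1 t01; have := powR_ge0 t s => ts0 ts1.
rewrite /f powRN invf_ge1 ?powR_gt0 ?subr_gt0//.
rewrite -[leRHS](one_powR s^-1) ge0_ler_powR ?nnegrE ?subr_ge0 ?(ltW ts1) ?(ltW sV0)//.
by rewrite gerBl.
Qed.

(** Follows from t^s <= t. The majorant has an integrable singularity at 1 because 1/s < 1. *)
Lemma arcsine_integrand_le (t : R) : 0 <= t < 1 -> f t <= (1 - t) `^ (- s^-1).
Proof.
move=> /[dup] t01 /andP[t0 t1]; have := powR_lt1 t01 => ts1.
rewrite /f !powRN lef_pV2 ?posrE ?powR_gt0 ?subr_gt0//.
rewrite ge0_ler_powR ?nnegrE ?subr_ge0 ?(ltW ts1) ?(ltW t1) ?(ltW sV0)//.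
rewrite lerB// -[leRHS]powRr1//.
have [->|tn0] := eqVneq t 0; first by rewrite !powR0 ?gt_eqF.
by apply: ger_powR; rewrite ?(ltW s1)// lt_neqAle eq_sym tn0 t0 ltW.
Qed.

Lemma continuous_arcsine_integrand (t : R) : 0 < t < 1 -> {for t, continuous f}.
Proof.
move=> /andP[t0 t1]; have ts1 : t `^ s < 1 by rewrite powR_lt1// ltW.
apply: differentiable_continuous; apply/derivable1_diffP.
have H : is_derive t 1 (cst 1 - @powR R ^~ s : R -> R) (0 - s * t `^ (s - 1)).
  by apply: is_deriveB; exact: is_derive1_powR.
have p1 : 0 < (cst 1 - (@powR R ^~ s)) t by rewrite !fctE subr_gt0.
have H2 := is_derive1_powR (- s^-1) p1.
by have [] := is_derive1_comp H2 H.
Qed.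

Lemma integral_arcsine_majorant (y : R) : 0 <= y < 1 ->
  (\int[mu]_(t in `[0%R, y]) ((1 - t) `^ (- s^-1))%:E <= ((1 - s^-1)^-1)%:E)%E.
Proof.
move=> /andP[y0 y1].
have e0 : 0 < 1 - s^-1 by rewrite subr_gt0.
pose F (z : R) := (1 - s^-1)^-1 * z `^ (1 - s^-1).
have dF (z : R) : 0 < z -> is_derive z 1 F (z `^ (- s^-1)).
  move=> z0; have -> : F = (1 - s^-1)^-1 \*: (@powR R ^~ (1 - s^-1) : R -> R).
    by apply/funext.
  apply: is_derive_eq (is_deriveZ _ (is_derive1_powR _ z0)) _.
  by rewrite /GRing.scale/= mulKf ?gt_eqF// addrC addKr.
have -> : (\int[mu]_(t in `[0%R, y]) ((1 - t) `^ (- s^-1))%:E =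
    \int[mu]_(t in `[0%R, y]) ((-1 * t + 1)%R `^ (- s^-1))%:E)%E.
  by apply: eq_integral => t _; rewrite mulN1r addrC.
have dF' z : 1 - y < z < 1 -> is_derive z 1 F (z `^ (- s^-1)).
  by move=> /andP[z0 _]; apply: dF; lra.
rewrite (integral_affine_FTC2 dF').
- rewrite lee_fin /F mulr0 add0r powR1 mulr1 invrN invr1 mulrN1 opprB gerBl.
  by rewrite mulr_ge0 ?powR_ge0// invr_ge0 ltW.
- move=> z; rewrite in_itv/= => /andP[z0 _].
  apply: differentiable_continuous; apply/derivable1_diffP.
  by have [|] := dF z; [lra|].
- move=> z; rewrite in_itv/= => /andP[z0 _].
  apply: differentiable_continuous; apply/derivable1_diffP.
  by apply: derivable_powR; rewrite in_itv/= andbT; lra.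
- by rewrite oppr_eq0 oner_eq0.
- by [].
- by apply/andP; split; lra.
- by apply/andP; split; lra.
Qed.

Lemma integrable_arcsine_integrand : mu.-integrable `[0, 1] (EFin \o f).
Proof.
have f0 t : (0 <= (f t)%:E)%E by rewrite lee_fin powR_ge0.
apply/integrableP; split; first by apply/measurable_EFinP; exact: measurable_arcsine_integrand.
under eq_integral => t _ do rewrite gee0_abs//=.
(* The singular endpoint is dropped, and [0, 1) is exhausted by the intervals [0, 1 - 1/(n+1)], on
   which the integrals have a common bound. *)
rewrite -integral_itv_bndo_bndc; last by apply/measurable_EFinP; exact: measurable_arcsine_integrand.
apply: (@le_lt_trans _ _ ((1 - s^-1)^-1)%:E%E); last exact: ltry.
rewrite itv_bnd_open_bigcup.
pose A n := `[0, 1 - n.+1%:R^-1 : R]%classic.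
have nA : nondecreasing_seq A.
  move=> m n mn; apply/subsetPset; apply: subset_itvl; rewrite bnd_simp.
  by rewrite lerB// lef_pV2 ?posrE ?ltr0n// ler_nat.
have mA i : measurable (A i) by exact: measurable_itv.
have mfA i : measurable_fun (A i) (EFin \o f).
  by apply/measurable_EFinP; exact: measurable_arcsine_integrand.
have f0A i x : A i x -> (0 <= (EFin \o f) x)%E by move=> _; exact: f0.
have C := @ge0_nondecreasing_set_cvg_integral _ (measurableTypeR R) R A
  (EFin \o f) mu nA mA mfA f0A.
rewrite -(cvg_lim _ C)//.
apply: lime_le.
  apply: ereal_nondecreasing_is_cvgn.
  exact: ge0_nondecreasing_set_nondecreasing_integral.
apply: nearW => n.
have n1 : 0 <= (1 - n.+1%:R^-1 : R) < 1.
  by rewrite subr_ge0 gtrBl invr_gt0 ltr0n andbT invf_le1 ?ler1n ?ltr0n.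
apply: le_trans (integral_arcsine_majorant n1).
apply: ge0_le_integral => //.
- exact: measurable_itv.
- exact: f0A.
- exact: mfA.
- apply/measurable_EFinP; apply: (measurableT_comp (@measurable_powR R _)).
  exact: measurable_funB.
- move=> t; rewrite /A/= in_itv/= lee_fin => /andP[t0 t1].
  by apply: arcsine_integrand_le; rewrite t0 (le_lt_trans t1)//; case/andP: n1.
Qed.

End arcsine_integral.

(** * The functions S and C on a quarter period *)

Section generalized_sine.
Set Implicit Arguments.
Unset Strict Implicit.
Context {R : realType}.
Notation mu := (@lebesgue_measure R).
Variable s : R.
Hypothesis s1 : 1 < s.

Let s0 : 0 < s. Proof. exact: lt_trans s1. Qed.
Let sV0 : 0 < s^-1. Proof. by rewrite invr_gt0. Qed.

Lemma Fs0 : Fs s 0 = 0.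
Proof. by rewrite /Fs set_itv1 Rintegral_set1. Qed.

Lemma Fs_expanding (x y : R) : 0 <= x -> x <= y -> y <= 1 ->
  y - x <= Fs s y - Fs s x.
Proof.
move=> x0 xy y1.
have iy : mu.-integrable `[0, y] (EFin \o (fun t : R => (1 - t `^ s) `^ (- s^-1))).
  apply: integrableS (integrable_arcsine_integrand s1) => //.
  by apply: subset_itvl; rewrite bnd_simp.
rewrite /Fs Rintegral_itvB// ?bnd_simp//.
have ixy : mu.-integrable `]x, y] (EFin \o (fun t : R => (1 - t `^ s) `^ (- s^-1))).
  by apply: integrableS iy => //; apply: subset_itvr; rewrite bnd_simp.
have ixy' : mu.-integrable `]x, y[ (EFin \o (fun t : R => (1 - t `^ s) `^ (- s^-1))).
  by apply: integrableS ixy => //; apply: subset_itvl; rewrite bnd_simp.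
(* The endpoint [y] must go: if y = 1 the integrand there is a negative power of 0, which [powR]
   sets to 0, so the lower bound 1 fails. *)
rewrite -Rintegral_itv_bndo_bndc//.
have -> : y - x = \int[mu]_(t in `]x, y[) 1.
  rewrite Rintegral_cst//= mul1r lebesgue_measure_itv/= lte_fin.
  by move: xy; rewrite le_eqVlt => /predU1P[->|->//]; rewrite ltxx subrr.
apply: le_Rintegral => //.
  apply: (@integrableS _ _ R mu `[x, y]) => //.
    exact: subset_itv_oo_cc.
  apply: continuous_compact_integrable; first exact: segment_compact.
  by apply: continuous_subspaceT => z; exact: cvg_cst.
move=> t /=; rewrite in_itv/= => /andP[xt ty].
by apply: arcsine_integrand_ge1 => //; rewrite (le_trans x0 (ltW xt)) (lt_le_trans ty).
Qed.

Lemma Fs_le (x y : R) : 0 <= x <= 1 -> 0 <= y <= 1 -> (Fs s x <= Fs s y) = (x <= y).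
Proof.
move=> /andP[x0 x1] /andP[y0 y1]; have [xy|yx] := leP x y.
  by have := Fs_expanding x0 xy y1; lra.
by apply/negbTE; rewrite -ltNge; have := Fs_expanding y0 (ltW yx) x1; lra.
Qed.

Lemma continuous_Fs : {within `[0, 1], continuous (Fs s)}.
Proof.
exact: (parameterized_integral_continuous ler01 (integrable_arcsine_integrand s1)).
Qed.

Lemma is_derive_Fs (y : R) : 0 < y < 1 ->
  is_derive y 1 (Fs s) ((1 - y `^ s) `^ (- s^-1)).
Proof.
move=> /[dup] y01 /andP[y0 y1].
have [dF <-] := @continuous_FTC1_closed R _ 0 y 1 y1
  (integrable_arcsine_integrand s1) y0 (continuous_arcsine_integrand s1 y01).
by rewrite derive1E; exact: DeriveDef.
Qed.

Notation h := (Fs s 1).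
Notation S := (sins_half s).

Lemma Fs1_gt0 : 0 < h.
Proof. by have := Fs_expanding (lexx 0) ler01 (lexx 1); rewrite Fs0; lra. Qed.

(** [Fs] is strictly increasing on [0, 1], so the set under the supremum is exactly [0, y]. *)
Lemma FsK (y : R) : 0 <= y <= 1 -> S (Fs s y) = y.
Proof.
move=> /[dup] y01 /andP[y0 y1]; rewrite /sins_half.
rewrite (_ : [set _ | _] = `[0, y]%classic) ?sup_itvcc//.
apply/seteqP; split => z /=; rewrite in_itv/=.
  by move=> [z01]; rewrite Fs_le// => ->; case/andP: z01 => ->.
by move=> /andP[z0 zy]; rewrite z0 (le_trans zy y1) Fs_le// z0 (le_trans zy y1).
Qed.

Lemma Fs_surj (x : R) : 0 <= x <= h -> exists2 y, 0 <= y <= 1 & Fs s y = x.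
Proof.
move=> /andP[x0 xh].
have [|y] := @IVT R (Fs s) 0 1 x ler01 continuous_Fs.
  by rewrite Fs0 min_l ?max_r ?x0// ltW// Fs1_gt0.
by rewrite in_itv/= => y01 Fy; exists y.
Qed.

Lemma sins_half_ge (x : R) : h <= x -> S x = 1.
Proof.
move=> hx; rewrite /sins_half (_ : [set _ | _] = `[0, 1]%classic) ?sup_itvcc//.
apply/seteqP; split => z /=; rewrite in_itv/=; first by case.
move=> z01; split => //; apply: le_trans hx; rewrite Fs_le//.
  by case/andP: z01.
by rewrite ler01 lexx.
Qed.

Lemma sins_half_le0 (x : R) : x <= 0 -> S x = 0.
Proof.
rewrite le_eqVlt => /predU1P[->|x0].
  by rewrite -[X in S X]Fs0 FsK// lexx ler01.
rewrite /sins_half (_ : [set _ | _] = set0) ?sup0//.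
apply/seteqP; split => z //= [z01 Fz]; have := le_lt_trans Fz x0.
rewrite -[X in _ < X]Fs0 ltNge Fs_le// ?lexx ?ler01//.
by case/andP: z01 => ->.
Qed.

(** A description of S valid on the whole line: it inverts [Fs] after clamping the argument to
    [0, h]. *)
Lemma sins_half_clamp (x : R) : exists y, [/\ 0 <= y <= 1, S x = y
  & Fs s y = Num.max 0 (Num.min x h)].
Proof.
have h0 := Fs1_gt0; have [x0|x0] := leP x 0.
  exists 0; rewrite lexx ler01 sins_half_le0// Fs0; split=> //.
  by rewrite min_l ?max_l// (le_trans x0)// ltW.
have [hx|xh] := leP h x.
  by exists 1; rewrite lexx ler01 sins_half_ge//; split => //; rewrite max_r// ltW.
have [|y y01 Fy] := @Fs_surj x; first by rewrite (ltW x0) ltW.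
by exists y; rewrite -{1}Fy FsK// max_r// ltW.
Qed.

Lemma sins_half01 (x : R) : 0 <= S x <= 1.
Proof. by have [y [? -> _]] := sins_half_clamp x. Qed.

Lemma Fs_sins_half (x : R) : 0 <= x <= h -> Fs s (S x) = x.
Proof. by move=> /Fs_surj[y y01 <-]; rewrite FsK. Qed.

(** Clamping does not increase distances, and neither does the inverse of an expanding map. *)
Lemma sins_half_lipschitz (x z : R) : x <= z -> `|S z - S x| <= z - x.
Proof.
move=> xz; have [y [/[dup] y01 /andP[y0 y1] -> Fy]] := sins_half_clamp x.
have [y' [/[dup] y'01 /andP[y'0 y'1] -> Fy']] := sins_half_clamp z.
have Fyy' : Fs s y <= Fs s y' /\ Fs s y' - Fs s y <= z - x.
  have := Fs1_gt0; rewrite Fy Fy'; set k := h => k0.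
  rewrite /Order.max /Order.min.
  by split; case: (ltP x k) => xk; case: (ltP z k) => zk;
    repeat case: ltP => ?; lra.
have yy' : y <= y' by rewrite -Fs_le//; case: Fyy'.
rewrite ger0_norm ?subr_ge0//; have := Fs_expanding y0 yy' y'1.
by case: Fyy' => _; lra.
Qed.

Lemma continuous_sins_half : continuous S.
Proof.
move=> x; apply/cvgrPdist_lt => e e0; near=> z.
have H : `|S x - S z| <= `|x - z|.
  have [xz|zx] := leP x z.
    by rewrite distrC (distrC x) (ger0_norm (_ : 0 <= z - x)) ?subr_ge0// sins_half_lipschitz.
  by rewrite (ger0_norm (_ : 0 <= x - z)) ?subr_ge0 ?(ltW zx)// sins_half_lipschitz// ltW.
apply: le_lt_trans H _.
by near: z; apply/nbhs_ballP; exists e.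
Unshelve. all: by end_near. Qed.

Lemma sins_half_gt0 (x : R) : 0 < x -> 0 < S x.
Proof.
move=> x0; case/andP: (sins_half01 x) => Sx0 _; rewrite lt_neqAle Sx0 andbT.
apply/eqP => Sx; have [hx|xh] := leP h x.
  by move: Sx; rewrite sins_half_ge//; apply/eqP; rewrite eq_sym oner_eq0.
have := @Fs_sins_half x; rewrite -Sx Fs0 (ltW x0) (ltW xh) => /(_ isT) x0'.
by move: x0; rewrite -x0' ltxx.
Qed.

Lemma sins_half_lt1 (x : R) : x < h -> S x < 1.
Proof.
move=> xh; case/andP: (sins_half01 x) => _ Sx1; rewrite lt_neqAle Sx1 andbT.
apply/eqP => Sx; have [x0|x0] := leP x 0.
  by move: Sx; rewrite sins_half_le0//; apply/eqP; rewrite eq_sym oner_eq0.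
have := @Fs_sins_half x; rewrite Sx (ltW x0) (ltW xh) => /(_ isT) x0'.
by move: xh; rewrite -x0' ltxx.
Qed.

(* [S] is 0 below 0 (supremum of an empty set or of [{0}]) and 1 above [h], hence
   continuous on the whole line; [coss_half] is its derivative on [0, h] only. *)
Definition coss_half (x : R) : R := (1 - S x `^ s) `^ s^-1.
Notation C := coss_half.

Lemma is_derive_sins_half (x : R) : 0 < x < h -> is_derive x 1 S (C x).
Proof.
move=> /andP[x0 xh]; have Sx0 := sins_half_gt0 x0; have Sx1 := sins_half_lt1 xh.
have Sx01 : 0 < S x < 1 by rewrite Sx0.
have FS : Fs s (S x) = x by apply: Fs_sins_half; rewrite !ltW.
(* C is put in the form of the reciprocal of the derivative of [Fs] at S x, as the inverse function
   rule expects. *)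
rewrite -[X in is_derive X]FS /coss_half -[_ `^ s^-1]invrK -powRN.
have Sin : S x \in `]0, 1[ by rewrite in_itv.
apply: is_derive_inverse.
- near=> z; apply: FsK.
  suff : z \in `]0, 1[ by rewrite in_itv/= => /andP[/ltW-> /ltW->].
  by near: z; exact: near_in_itvoo.
- near=> z; apply: differentiable_continuous; apply/derivable1_diffP.
  suff : z \in `]0, 1[ by rewrite in_itv/= => /is_derive_Fs [].
  by near: z; exact: near_in_itvoo.
- exact: is_derive_Fs.
- rewrite gt_eqF// powR_gt0// subr_gt0; apply: powR_lt1 => //.
  by rewrite ltW.
Unshelve. all: by end_near. Qed.

Lemma powR_sins_half01 (x r : R) : 0 < r -> 0 <= S x `^ r <= 1.
Proof.
move=> r0; rewrite powR_ge0/=; have /andP[S0 S1] := sins_half01 x.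
have := @ge0_ler_powR R r (ltW r0) (S x) 1.
by rewrite !nnegrE S0 ler01 powR1 => /(_ isT isT S1).
Qed.

Lemma coss_half01 (x : R) : 0 <= C x <= 1.
Proof.
rewrite powR_ge0/=; have /andP[S0 S1] := powR_sins_half01 x s0.
have := @ge0_ler_powR R s^-1 (ltW sV0) (1 - S x `^ s) 1.
by rewrite !nnegrE subr_ge0 S1 ler01 powR1; apply => //; rewrite gerBl.
Qed.

Lemma coss_half_gt0 (x : R) : x < h -> 0 < C x.
Proof.
move=> xh; rewrite powR_gt0// subr_gt0 powR_lt1// sins_half_lt1// andbT.
by case/andP: (sins_half01 x).
Qed.

Lemma coss_half_Fs1 : C h = 0.
Proof.
by rewrite /coss_half sins_half_ge// powR1 subrr powR0// gt_eqF.
Qed.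

Lemma coss_half_powR (x : R) : C x `^ s = 1 - S x `^ s.
Proof.
rewrite /coss_half -powRrM mulVf ?gt_eqF// powRr1// subr_ge0.
by case/andP: (powR_sins_half01 x s0).
Qed.

Lemma continuous_sins_half_powR (r : R) : 0 < r -> continuous (fun x => S x `^ r).
Proof.
move=> r0; have -> : (fun x => S x `^ r) = (fun y : R => `|y| `^ r) \o S.
  by apply/funext => x /=; rewrite ger0_norm//; case/andP: (sins_half01 x).
move=> x; apply: continuous_comp; first exact: continuous_sins_half.
exact: continuous_powR_norm.
Qed.

Lemma continuous_coss_half : continuous C.
Proof.
have -> : C = (fun y : R => `|y| `^ s^-1) \o (fun x => 1 - S x `^ s).
  apply/funext => x /=; rewrite ger0_norm// subr_ge0.
  by case/andP: (powR_sins_half01 x s0).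
move=> x; apply: continuous_comp; last exact: continuous_powR_norm.
by apply: cvgB; [exact: cvg_cst|exact: continuous_sins_half_powR].
Qed.

Lemma continuous_coss_half_powR (r : R) : 0 < r -> continuous (fun x => C x `^ r).
Proof.
move=> r0; have -> : (fun x => C x `^ r) = (fun y : R => `|y| `^ r) \o C.
  by apply/funext => x /=; rewrite ger0_norm// powR_ge0.
move=> x; apply: continuous_comp; first exact: continuous_coss_half.
exact: continuous_powR_norm.
Qed.

(** This is the differential equation of sin_s on the first quarter period, where |S'|^(s-2) S' =
    C^(s-1). *)
Lemma is_derive_coss_half_powR (x : R) : 0 < x < h ->
  is_derive x 1 (fun x => C x `^ (s - 1)) (- (s - 1) * S x `^ (s - 1)).
Proof.
move=> /[dup] x0h /andP[x0 xh]; have Sx0 := sins_half_gt0 x0.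
have Cx0 := coss_half_gt0 xh.
(* C^(s-1) = (1 - S^s)^e, so the chain rule needs only the derivative of S; e - 1 = -1/s then makes
   the factor C cancel. *)
pose e := s^-1 * (s - 1).
have p1 : 0 < 1 - S x `^ s.
  by rewrite subr_gt0 powR_lt1// sins_half_lt1// ltW.
have d1 := is_derive1_comp (is_derive1_powR s Sx0) (is_derive_sins_half x0h).
have d2 := is_deriveB (is_derive_cst (1 : R) x 1) d1.
have d3 := is_derive1_comp (is_derive1_powR e (p1 : 0 < (cst 1 - ((@powR R ^~ s) \o S)) x)) d2.
have -> : (fun x => C x `^ (s - 1)) = (@powR R ^~ e) \o (cst 1 - ((@powR R ^~ s) \o S)).
  by apply/funext => z; rewrite /coss_half -powRrM.
apply: is_derive_eq d3 _.
rewrite !fctE sub0r.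
have E1 : (1 - S x `^ s) `^ (e - 1) * C x = 1.
  rewrite /coss_half -powRD; last by rewrite (gt_eqF p1) implybT.
  by rewrite (_ : e - 1 + s^-1 = 0) ?powRr0// /e; field; rewrite gt_eqF.
have E2 : e * s = s - 1 by rewrite /e; field; rewrite gt_eqF.
transitivity (- (e * s) * S x `^ (s - 1) * ((1 - S x `^ s) `^ (e - 1) * C x)); first by ring.
by rewrite E1 mulr1 E2.
Qed.

End generalized_sine.

(** * Splitting at an interior point, and integrability in W10 *)

Section interval_integrals.
Set Implicit Arguments.
Unset Strict Implicit.
Context {R : realType}.
Notation mu := (@lebesgue_measure R).

Lemma ge0_integral_itv_split (a m b : R) (f : R -> \bar R) :
  a < m -> m < b -> measurable_fun `[a, b] f ->
  (forall x, a <= x <= b -> (0 <= f x)%E) ->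
  (\int[mu]_(x in `[a, b]) f x =
   \int[mu]_(x in `]a, m[) f x + \int[mu]_(x in `]m, b[) f x)%E.
Proof.
move=> am mb mf f0.
have mfS : forall c d b0 b1, a <= c -> d <= b ->
    measurable_fun [set` Interval (BSide b0 c) (BSide b1 d)] f.
  move=> c d b0 b1 ac db; apply: measurable_funS mf => //.
  by apply: subset_itv; [case: b0|case: b1]; rewrite bnd_simp// ltW.
rewrite (@itv_bndbnd_setU _ _ _ (BRight m)) ?bnd_simp ?ltW//.
rewrite ge0_integral_setU//=.
- congr (_ + _)%E.
    rewrite -integral_itv_bndo_bndc; last by apply: mfS => //; exact: ltW.
    by rewrite -integral_itv_obnd_cbnd//; apply: mfS => //; exact: ltW.
  by rewrite -integral_itv_bndo_bndc//; apply: mfS => //; exact: ltW.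
- by rewrite -itv_bndbnd_setU ?bnd_simp ?ltW//.
- move=> x [|]/=; rewrite in_itv/= => /andP[x1 x2]; apply: f0.
    by rewrite x1 (le_trans x2)// ltW.
  by rewrite x2 (le_trans (ltW am) (ltW x1)).
- apply/disj_setPS => y [/=]; rewrite 2!in_itv/= => /andP[_ ym] /andP[].
  by rewrite ltNge ym.
Qed.

(** On a bounded interval, |g| <= 1 + |g|^s gives the domination. *)
Lemma W10_integrable (s a b : R) (u g : R -> R) : 1 < s -> W10 s a b u g ->
  mu.-integrable `[a, b] (EFin \o g).
Proof.
move=> s1 [mg ig _ _].
have i1 : mu.-integrable `[a, b] (EFin \o (cst (1 : R))).
  apply: continuous_compact_integrable; first exact: segment_compact.
  by apply: continuous_subspaceT => z; exact: cvg_cst.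
have := integrableD _ i1 ig; rewrite /= => /(_ (measurable_itv _)) ii.
apply: le_integrable ii => //; first exact/measurable_EFinP.
move=> x _ /=; rewrite lee_fin; apply: le_trans (ler_norm _).
have [g1|g1] := leP `|g x| 1.
  by rewrite (le_trans g1)// lerDl powR_ge0.
rewrite (@le_trans _ _ (`|g x| `^ s))//; last by rewrite lerDr.
by apply: le1r_powR; rewrite ltW.
Qed.

Lemma W10_measurable (s a b : R) (u g : R -> R) : 1 < s -> a <= b ->
  W10 s a b u g -> measurable_fun `[a, b] u.
Proof.
move=> s1 ab W; have ig := W10_integrable s1 W; case: W => mg _ ug _.
apply: (@eq_measurable_fun _ _ _ _ _ (fun x => parameterized_integral mu a x g)).
  by move=> x; rewrite inE/= in_itv/= => xab; rewrite ug.
apply: subspace_continuous_measurable_fun => //.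
exact: parameterized_integral_continuous.
Qed.

Lemma EFin_Rintegral_norm (a b : R) (A : set R) (g : R -> R) :
  measurable A -> A `<=` `[a, b] -> mu.-integrable `[a, b] (EFin \o g) ->
  (`|\int[mu]_(t in A) g t|%:E <= \int[mu]_(t in A) `|g t|%:E)%E.
Proof.
move=> mA Aab ig; have igA : mu.-integrable A (EFin \o g) by exact: integrableS ig.
rewrite EFin_normr_Rintegral//; apply: le_abse_integral => //.
by case/integrableP : igA.
Qed.

End interval_integrals.

(** * Integrals of C and S^(s-1) *)

Section sine_integrals.
Set Implicit Arguments.
Unset Strict Implicit.
Context {R : realType}.
Notation mu := (@lebesgue_measure R).
Variable s : R.
Hypothesis s1 : 1 < s.

Notation h := (Fs s 1).
Notation S := (sins_half s).
Notation C := (coss_half s).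

Lemma integral_coss_half (k l x y : R) : k != 0 -> x <= y ->
  0 <= k * x + l <= h -> 0 <= k * y + l <= h ->
  (\int[mu]_(t in `[x, y]) (C (k * t + l)%R)%:E =
   ((S (k * y + l) - S (k * x + l)) / k)%:E)%E.
Proof.
move=> k0 xy kx ky; apply: (integral_affine_FTC2 (is_derive_sins_half s1)) => //.
- by move=> z _; exact: continuous_sins_half.
- by move=> z _; exact: continuous_coss_half.
Qed.

Lemma integral_sins_half_powRB1 (k l x y : R) : k != 0 -> x <= y ->
  0 <= k * x + l <= h -> 0 <= k * y + l <= h ->
  (\int[mu]_(t in `[x, y]) (S (k * t + l)%R `^ (s - 1))%:E =
   ((C (k * x + l) `^ (s - 1) - C (k * y + l) `^ (s - 1)) / ((s - 1) * k))%:E)%E.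
Proof.
move=> k0 xy kx ky; have s10 : 0 < s - 1 by rewrite subr_gt0.
have sn0 : s - 1 != 0 by rewrite gt_eqF.
have E (A B : R) : (- (s - 1)^-1 * B - - (s - 1)^-1 * A) / k =
    (A - B) / ((s - 1) * k).
  by field; rewrite sn0 k0.
pose F z : R := - (s - 1)^-1 * C z `^ (s - 1).
have dF z : 0 < z < h -> is_derive z 1 F (S z `^ (s - 1)).
  move=> z0h; have := is_derive_eq (is_deriveZ (- (s - 1)^-1)
    (is_derive_coss_half_powR s1 z0h)).
  by apply; rewrite /GRing.scale/=; field.
rewrite (integral_affine_FTC2 dF)//.
- by rewrite E.
- move=> z _; apply: cvgM; first exact: cvg_cst.
  exact: continuous_coss_half_powR.
- by move=> z _; exact: continuous_sins_half_powR.
Qed.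

End sine_integrals.

(** * Sharp Poincare inequality and the trial function *)

Section sharp_poincare.
Set Implicit Arguments.
Unset Strict Implicit.
Context {R : realType}.
Notation mu := (@lebesgue_measure R).
Variables (s a b : R).
Hypotheses (s1 : 1 < s) (ab : a < b).

Notation h := (Fs s 1).
Notation S := (sins_half s).
Notation C := (coss_half s).
Notation m := ((a + b) / 2).
Notation k := (pis s / (b - a)).
Notation K := ((k `^ s)^-1 / (s - 1)).

Let h0 : 0 < h. Proof. exact: Fs1_gt0. Qed.
Let s10 : 0 < s - 1. Proof. by rewrite subr_gt0. Qed.
Let ba0 : 0 < b - a. Proof. by rewrite subr_gt0. Qed.

Lemma pis_gt0 : 0 < pis s. Proof. by rewrite /pis mulr_gt0. Qed.

Let k0 : 0 < k. Proof. by rewrite divr_gt0// pis_gt0. Qed.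

Let K0 : 0 <= K. Proof. by rewrite divr_ge0 ?invr_ge0 ?powR_ge0// ltW. Qed.

(** With this [k], each half of the interval is mapped onto [0, h], the outer endpoint going to 0
    and the midpoint to h. *)
Let km : k * (m - a) = h.
Proof. rewrite /pis; field; exact: lt0r_neq0. Qed.

Let am : a < m. Proof. by rewrite midf_lt. Qed.
Let mb : m < b. Proof. by rewrite midf_lt. Qed.

Let left_range x : a <= x <= m -> 0 <= k * x + - (k * a) <= h.
Proof.
move=> /andP[ax xm]; rewrite -mulrBr mulr_ge0 ?subr_ge0 ?(ltW k0)//=.
by rewrite -km ler_pM2l//; lra.
Qed.

Let left_range_lt x : a < x < m -> 0 < k * x + - (k * a) < h.
Proof.
move=> /andP[ax xm]; rewrite -mulrBr mulr_gt0 ?subr_gt0//=.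
by rewrite -km ltr_pM2l//; lra.
Qed.

Let km' : k * (b - m) = h.
Proof. by rewrite -km (_ : b - m = m - a)//; lra. Qed.

Let right_range x : m <= x <= b -> 0 <= - k * x + k * b <= h.
Proof.
move=> /andP[ax xm]; rewrite mulNr addrC -mulrBr mulr_ge0 ?subr_ge0 ?(ltW k0)//=.
by rewrite -km' ler_pM2l//; lra.
Qed.

Let right_range_lt x : m < x < b -> 0 < - k * x + k * b < h.
Proof.
move=> /andP[ax xm]; rewrite mulNr addrC -mulrBr mulr_gt0 ?subr_gt0//=.
by rewrite -km' ltr_pM2l//; lra.
Qed.

(** Accounts for the scaling: k^(1-s) comes from the factor 1/k in the integrated weight, a further
    1/k from the substitution. *)
Let KE (c : R) : k^-1 `^ (s - 1) * (c / ((s - 1) * k)) = K * c.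
Proof.
have sn0 : s - 1 != 0 by rewrite gt_eqF.
move: k k0 => x x0; have xs : x `^ (s - 1) != 0 by rewrite gt_eqF// powR_gt0.
rewrite -powR_inv1 ?(ltW x0)// -powRrM mulN1r powRN.
rewrite -(mulr_powRB1 (ltW x0) (lt_trans ltr01 s1)).
by field; rewrite sn0 xs gt_eqF.
Qed.

Let c_affine (F : R -> R) (k' l : R) : continuous F ->
  continuous (fun t => F (k' * t + l)).
Proof.
move=> cF t.
apply: continuous_comp; [exact: continuous_affine|exact: cF].
Qed.

Let m_affine (F : R -> R) (k' l : R) D : continuous F ->
  measurable_fun D (fun t => F (k' * t + l)).
Proof.
by move=> cF; apply: measurable_funTS; apply: continuous_measurable_fun; exact: c_affine.
Qed.

Let poincare_left u g : W10 s a b u g ->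
  (\int[mu]_(x in `]a, m[) (`|u x| `^ s)%:E <=
   K%:E * \int[mu]_(x in `]a, m[) (`|g x| `^ s)%:E)%E.
Proof.
move=> W; have ig := W10_integrable s1 W; have mu_ := W10_measurable s1 (ltW ab) W.
have sub : `]a, m[ `<=` `[a, b].
  by apply: subset_itv; rewrite bnd_simp// ltW.
(* The kernel t <= x encodes u(x) = int_a^x g. *)
pose e : set (R * R) := [set z | z.2 <= z.1].
have me : measurable e.
  rewrite -[e]setTI.
  exact: (measurable_fun_ler (D := setT) (f := snd) (g := fst) measurable_snd measurable_fst
    measurableT (Logic.I : measurable [set true])).
have ex x : a < x < m -> `]a, m[ `&` xsection e x = `]a, x]%classic.
  move=> /andP[ax xm]; apply/seteqP; split => t; rewrite /xsection/= !in_itv/= inE/=.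
    by move=> [/andP[-> _]].
  by move=> /andP[-> tx]; rewrite (le_lt_trans tx xm).
have ey t : a < t < m -> `]a, m[ `&` ysection e t = `[t, m[%classic.
  move=> /andP[at_ tm]; apply/seteqP; split => x; rewrite /ysection/= !in_itv/= inE/=.
    by move=> [/andP[_ ->] ->].
  by move=> /andP[tx ->]; rewrite (lt_le_trans at_ tx).
apply: (@schur_test _ _ R mu `]a, m[ e u g (fun t => C (k * t + - (k * a)))
   (fun x => k^-1 * S (k * x + - (k * a)))) => //.
- exact: measurable_funS mu_.
- by case: W => mg _ _ _; exact: measurable_funS mg.
- exact: m_affine (continuous_coss_half s1).
- by apply: measurable_funM => //; exact: m_affine (continuous_sins_half s1).
- by move=> x /=; rewrite in_itv/= => /left_range_lt/andP[_]; exact: coss_half_gt0.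
- move=> x /=; rewrite in_itv/= => /left_range_lt/andP[x0 _].
  by rewrite mulr_gt0 ?invr_gt0//; exact: sins_half_gt0.
- move=> x /=; rewrite in_itv/= => xam; rewrite ex//.
  have /andP[ax xm] := xam; case: W => _ _ ug _.
  rewrite ug; last by rewrite (ltW ax) (le_trans (ltW xm) (ltW mb)).
  have xb : x <= b by rewrite (le_trans (ltW xm) (ltW mb)).
  rewrite -Rintegral_itv_obnd_cbnd.
    apply: (EFin_Rintegral_norm _ _ ig) => //.
    by apply: subset_itv; rewrite bnd_simp.
  by apply: integrableS ig => //; apply: subset_itv; rewrite bnd_simp.
- move=> x /=; rewrite in_itv/= => xam; rewrite ex//.
  have /andP[ax xm] := xam.
  rewrite integral_itv_obnd_cbnd; last first.
    by apply/measurable_EFinP; exact: m_affine (continuous_coss_half s1).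
  rewrite integral_coss_half ?(lt0r_neq0 k0) ?(ltW ax)//.
  + by rewrite subrr [S 0]sins_half_le0// subr0 mulrC.
  + by apply: left_range; rewrite lexx ltW.
  + by apply: left_range; rewrite !ltW.
- move=> t /=; rewrite in_itv/= => tam; rewrite ey//.
  have /andP[at_ tm] := tam.
  have mS : measurable_fun `[t, m[ (fun x => S (k * x + - (k * a)) `^ (s - 1)).
    exact: (@m_affine (fun z => S z `^ (s - 1)) k (- (k * a)) _
      (continuous_sins_half_powR s1 s10)).
  under eq_integral => x _.
    rewrite powRM ?invr_ge0 ?(ltW k0)//; last by case/andP: (sins_half01 s1 (k * x + - (k * a))).
    rewrite EFinM; over.
  rewrite ge0_integralZl//; last 3 first.
  + exact/measurable_EFinP.
  + by move=> x _; rewrite lee_fin powR_ge0.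
  + by rewrite lee_fin powR_ge0.
  rewrite integral_itv_bndo_bndc; last exact/measurable_EFinP.
  rewrite integral_sins_half_powRB1 ?(lt0r_neq0 k0) ?(ltW tm)//.
  (* The boundary term at the midpoint is C(h)^(s-1) = 0, so exactly the weight at [t] is
     returned. *)
  + rewrite -(mulrBr k m a) km coss_half_Fs1// powR0 ?lt0r_neq0// subr0 -EFinM.
    by rewrite KE.
  + by apply: left_range; rewrite !ltW.
  + by apply: left_range; rewrite lexx ltW.
Qed.

(** Mirror image of the left half: the condition u(b) = 0 gives u(x) = - int_x^b g, hence the kernel
    x <= t and the weight C(k(b - t)). *)
Let poincare_right u g : W10 s a b u g ->
  (\int[mu]_(x in `]m, b[) (`|u x| `^ s)%:E <=
   K%:E * \int[mu]_(x in `]m, b[) (`|g x| `^ s)%:E)%E.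
Proof.
move=> W; have ig := W10_integrable s1 W; have mu_ := W10_measurable s1 (ltW ab) W.
have nk0 : - k != 0 by rewrite oppr_eq0 lt0r_neq0.
have sub : `]m, b[ `<=` `[a, b].
  by apply: subset_itv; rewrite bnd_simp// ltW.
pose e : set (R * R) := [set z | z.1 <= z.2].
have me : measurable e.
  rewrite -[e]setTI.
  exact: (measurable_fun_ler (D := setT) (f := fst) (g := snd) measurable_fst measurable_snd
    measurableT (Logic.I : measurable [set true])).
have ex x : m < x < b -> `]m, b[ `&` xsection e x = `[x, b[%classic.
  move=> /andP[ax xm]; apply/seteqP; split => t; rewrite /xsection/= !in_itv/= inE/=.
    by move=> [/andP[_ ->] ->].
  by move=> /andP[tx ->]; rewrite (lt_le_trans ax tx).
have ey t : m < t < b -> `]m, b[ `&` ysection e t = `]m, t]%classic.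
  move=> /andP[at_ tm]; apply/seteqP; split => x; rewrite /ysection/= !in_itv/= inE/=.
    by move=> [/andP[-> _]].
  by move=> /andP[-> tx]; rewrite (le_lt_trans tx tm).
apply: (@schur_test _ _ R mu `]m, b[ e u g (fun t => C (- k * t + k * b))
   (fun x => k^-1 * S (- k * x + k * b))) => //.
- exact: measurable_funS mu_.
- by case: W => mg _ _ _; exact: measurable_funS mg.
- exact: m_affine (continuous_coss_half s1).
- by apply: measurable_funM => //; exact: m_affine (continuous_sins_half s1).
- by move=> x /=; rewrite in_itv/= => /right_range_lt/andP[_]; exact: coss_half_gt0.
- move=> x /=; rewrite in_itv/= => /right_range_lt/andP[x0 _].
  by rewrite mulr_gt0 ?invr_gt0//; exact: sins_half_gt0.
- move=> x /=; rewrite in_itv/= => xam; rewrite ex//.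
  have /andP[ax xm] := xam; case: W => _ _ ug ub.
  have ax' : a <= x by rewrite (le_trans (ltW am) (ltW ax)).
  have igx : mu.-integrable `]x, b] (EFin \o g).
    by apply: integrableS ig => //; apply: subset_itv; rewrite bnd_simp.
  have igx' : mu.-integrable `]x, b[ (EFin \o g).
    by apply: integrableS igx => //; apply: subset_itv; rewrite bnd_simp.
  have -> : `|u x| = `|u b - u x| by rewrite ub sub0r normrN.
  rewrite (ug b) ?lexx ?(ltW ab)// (ug x) ?ax' ?(ltW xm)//.
  rewrite Rintegral_itvB ?bnd_simp ?(ltW xm)//.
  rewrite -Rintegral_itv_bndo_bndc//.
  rewrite -integral_itv_obnd_cbnd; last first.
    by apply/measurable_EFinP; apply: measurableT_comp => //; case/integrableP: igx' => /measurable_EFinP.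
  apply: (EFin_Rintegral_norm _ _ ig) => //.
  by apply: subset_itv; rewrite bnd_simp.
- move=> x /=; rewrite in_itv/= => xam; rewrite ex//.
  have /andP[ax xm] := xam.
  rewrite integral_itv_bndo_bndc; last first.
    by apply/measurable_EFinP; exact: m_affine (continuous_coss_half s1).
  rewrite integral_coss_half ?(ltW xm)//.
  + rewrite mulNr addNr [S 0]sins_half_le0// sub0r invrN mulrNN mulrC mulNr//.
  + by apply: right_range; rewrite !ltW.
  + by apply: right_range; rewrite lexx ltW.
- move=> t /=; rewrite in_itv/= => tam; rewrite ey//.
  have /andP[at_ tm] := tam.
  have mS : measurable_fun `]m, t] (fun x => S (- k * x + k * b) `^ (s - 1)).
    exact: (@m_affine (fun z => S z `^ (s - 1)) (- k) (k * b) _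
      (continuous_sins_half_powR s1 s10)).
  under eq_integral => x _.
    rewrite powRM ?invr_ge0 ?(ltW k0)//; last by case/andP: (sins_half01 s1 (- k * x + k * b)).
    rewrite EFinM; over.
  rewrite ge0_integralZl//; last 3 first.
  + exact/measurable_EFinP.
  + by move=> x _; rewrite lee_fin powR_ge0.
  + by rewrite lee_fin powR_ge0.
  rewrite integral_itv_obnd_cbnd; last exact/measurable_EFinP.
  rewrite integral_sins_half_powRB1 ?(ltW at_)//.
  + rewrite mulNr [in C (- (k * m) + _)]addrC -mulrBr km' coss_half_Fs1// powR0 ?lt0r_neq0// sub0r -EFinM.
    by rewrite (mulrN (s - 1)) invrN mulrNN KE.
  + by apply: right_range; rewrite lexx ltW.
  + by apply: right_range; rewrite !ltW.
Qed.

Lemma sharp_poincare u g : W10 s a b u g ->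
  (s - 1) * k `^ s * \int[mu]_(x in `[a, b]) (`|u x| `^ s) <=
  \int[mu]_(x in `[a, b]) (`|g x| `^ s).
Proof.
move=> W; have mu_ := W10_measurable s1 (ltW ab) W.
have mp (f : R -> R) : measurable_fun `[a, b] f ->
    measurable_fun `[a, b] (fun x => (`|f x| `^ s)%:E).
  move=> mf; apply/measurable_EFinP; apply: (measurableT_comp (@measurable_powR R s)).
  exact: measurableT_comp.
have mg : measurable_fun `[a, b] g by case: W.
have f0 (f : R -> R) x : (0 <= (`|f x| `^ s)%:E)%E by rewrite lee_fin powR_ge0.
have : (\int[mu]_(x in `[a, b]) (`|u x| `^ s)%:E <=
    K%:E * \int[mu]_(x in `[a, b]) (`|g x| `^ s)%:E)%E.
  rewrite (ge0_integral_itv_split am mb (mp _ mu_))//.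
  rewrite (ge0_integral_itv_split am mb (mp _ mg))//.
  rewrite ge0_muleDr ?integral_ge0//.
  by apply: leeD; [exact: poincare_left|exact: poincare_right].
have ig : mu.-integrable `[a, b] (EFin \o (fun x => `|g x| `^ s)) by case: W.
have fg : (\int[mu]_(x in `[a, b]) (`|g x| `^ s)%:E)%E \is a fin_num.
  by apply: integrable_fin_num.
rewrite /Rintegral -{1}(fineK fg) -EFinM => H.
(* Finiteness of int |u|^s is a consequence of the extended inequality, as int |g|^s is finite. *)
have fu : (\int[mu]_(x in `[a, b]) (`|u x| `^ s)%:E)%E \is a fin_num.
  rewrite ge0_fin_numE ?integral_ge0//; exact: le_lt_trans H (ltry _).
move: H; rewrite -{1}(fineK fu) lee_fin => H.
have ks : 0 < k `^ s by rewrite powR_gt0.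
rewrite -ler_pdivlMl ?mulr_gt0//; apply: le_trans H _.
by rewrite invfM (mulrC (s - 1)^-1).
Qed.


Let SC (x : R) := S x * C x `^ (s - 1).

(** As C^s + S^s = 1, this derivative is both 1 - s S^s and s C^s - (s-1). Since [SC] vanishes at 0
    and h, it drops out of the definite integrals. *)
Let dSC x : 0 < x < h -> is_derive x 1 SC (C x `^ s - (s - 1) * S x `^ s).
Proof.
move=> x0h; have /andP[x0 xh] := x0h.
have := is_deriveM (is_derive_sins_half s1 x0h) (is_derive_coss_half_powR s1 x0h).
move=> /is_derive_eq; apply; rewrite /GRing.scale/=.
rewrite -(mulr_powRB1 (ltW (coss_half_gt0 s1 xh)) (lt_trans ltr01 s1)).
rewrite -(mulr_powRB1 (ltW (sins_half_gt0 s1 x0)) (lt_trans ltr01 s1)).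
by ring.
Qed.

Let continuous_SC : continuous SC.
Proof.
move=> x; apply: cvgM; first exact: continuous_sins_half.
exact: continuous_coss_half_powR.
Qed.

Let SC0 : SC 0 = 0. Proof. by rewrite /SC sins_half_le0// mul0r. Qed.
Let SCh : SC h = 0.
Proof. by rewrite /SC coss_half_Fs1// powR0 ?mulr0// lt0r_neq0. Qed.

(** Here f depends only on the distance to the nearer endpoint, so both halves contribute
    equally. *)
Let symmetric_integral (f F : R -> R) (phi : R -> R) :
  measurable_fun `[a, b] f -> (forall x, 0 <= f x) ->
  (forall x, a < x < m -> f x = phi (k * x + - (k * a))) ->
  (forall x, m < x < b -> f x = phi (- k * x + k * b)) ->
  continuous phi -> continuous F ->
  (forall z, 0 < z < h -> is_derive z 1 F (phi z)) ->
  (\int[mu]_(x in `[a, b]) (f x)%:E = (2 * (F h - F 0) / k)%:E)%E.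
Proof.
move=> mf f0 fl fr cphi cF dF.
rewrite (ge0_integral_itv_split am mb)//; last 2 first.
- exact/measurable_EFinP.
- by move=> x _; rewrite lee_fin.
have -> : (\int[mu]_(x in `]a, m[) (f x)%:E =
    \int[mu]_(x in `[a, m]) (phi (k * x + - (k * a))%R)%:E)%E.
  rewrite [RHS]integral_itv_bndoo; last by apply/measurable_EFinP; exact: m_affine.
  by apply: eq_integral => x; rewrite inE/= in_itv/= => /fl ->.
have -> : (\int[mu]_(x in `]m, b[) (f x)%:E =
    \int[mu]_(x in `[m, b]) (phi (- k * x + k * b)%R)%:E)%E.
  rewrite [RHS]integral_itv_bndoo; last by apply/measurable_EFinP; exact: m_affine.
  by apply: eq_integral => x; rewrite inE/= in_itv/= => /fr ->.
have nk0 : - k != 0 by rewrite oppr_eq0 lt0r_neq0.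
rewrite (integral_affine_FTC2 dF) ?(lt0r_neq0 k0) ?(ltW am)//; last 2 first.
- by apply: left_range; rewrite lexx ltW.
- by apply: left_range; rewrite lexx ltW.
rewrite (integral_affine_FTC2 dF) ?(ltW mb)//; last 2 first.
- by apply: right_range; rewrite lexx ltW.
- by apply: right_range; rewrite lexx ltW.
rewrite -mulrBr km subrr !mulNr addNr [in F (- (k * m) + _)]addrC -mulrBr km'.
rewrite -EFinD; congr (_%:E); rewrite invrN mulrN -mulNr opprB -mulrDl.
by congr (_ / k); rewrite -mulr2n mulr_natl.
Qed.

Definition sine_trial (x : R) : R := k^-1 * sins s (k * (x - a)).

(** The sign on the right half comes from the reflection in [sins]; at the midpoint both branches
    give C(h) = 0. *)
Definition sine_trial_deriv (x : R) : R :=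
  if x <= m then C (k * x + - (k * a)) else - C (- k * x + k * b).

Let pis_half : pis s / 2 = h.
Proof. by rewrite /pis mulrAC divff ?mul1r. Qed.

Let sins_left x : x <= m -> sins s (k * (x - a)) = S (k * x + - (k * a)).
Proof.
move=> xm; rewrite /sins pis_half -km ler_pM2l// lerD2r xm.
by rewrite mulrBr.
Qed.

Let sins_right x : m < x -> sins s (k * (x - a)) = S (- k * x + k * b).
Proof.
move=> xm; rewrite /sins pis_half -km ler_pM2l// lerD2r leNgt xm /=.
congr (S _); rewrite mulrBr mulNr.
(* This identifies pi_s - k(x - a) with k(b - x). *)
have -> : k * b = k * a + pis s.
  have e : k * (b - a) = pis s by rewrite divfK// lt0r_neq0.
  by rewrite -[LHS](subrK (k * a)) -mulrBr e addrC.
by ring.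
Qed.

Let sine_trial_deriv_norm x : `|sine_trial_deriv x| = if x <= m then C (k * x + - (k * a)) else C (- k * x + k * b).
Proof.
rewrite /sine_trial_deriv; case: ifP => _; rewrite ?normrN ger0_norm//.
  by case/andP: (coss_half01 s1 (k * x + - (k * a))).
by case/andP: (coss_half01 s1 (- k * x + k * b)).
Qed.

Lemma sine_trial_deriv_norm_le1 x : `|sine_trial_deriv x| <= 1.
Proof.
rewrite sine_trial_deriv_norm; case: ifP => _.
  by case/andP: (coss_half01 s1 (k * x + - (k * a))).
by case/andP: (coss_half01 s1 (- k * x + k * b)).
Qed.

Lemma measurable_sine_trial_deriv D : measurable_fun D sine_trial_deriv.
Proof.
apply: measurable_funTS; apply: measurable_fun_ifT.
- exact: measurable_fun_ler.
- exact: m_affine (continuous_coss_half s1).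
- by apply: measurable_funN; exact: m_affine (continuous_coss_half s1).
Qed.

Lemma measurable_sine_trial D : measurable_fun D sine_trial.
Proof.
apply: measurable_funTS.
have -> : sine_trial = fun x => k^-1 * (if x <= m then S (k * x + - (k * a)) else S (- k * x + k * b)).
  apply/funext => x; rewrite /sine_trial; case: (leP x m) => [/sins_left ->|/sins_right ->]//.
apply: measurable_funM => //; apply: measurable_fun_ifT.
- exact: measurable_fun_ler.
- exact: m_affine (continuous_sins_half s1).
- exact: m_affine (continuous_sins_half s1).
Qed.

Lemma integrable_sine_trial_deriv_powR (r : R) : 0 < r ->
  mu.-integrable `[a, b] (fun x => (`|sine_trial_deriv x| `^ r)%:E).
Proof.
move=> r0.
have i1 : mu.-integrable `[a, b] (EFin \o (cst (1 : R))).
  apply: continuous_compact_integrable; first exact: segment_compact.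
  by apply: continuous_subspaceT => z; exact: cvg_cst.
apply: le_integrable i1 => //.
  apply/measurable_EFinP; apply: (measurableT_comp (@measurable_powR R r)).
  by apply: measurableT_comp => //; exact: measurable_sine_trial_deriv.
move=> x _ /=; rewrite lee_fin normr1 ger0_norm ?powR_ge0//.
have := @ge0_ler_powR R r (ltW r0) `|sine_trial_deriv x| 1.
by rewrite !nnegrE powR1 normr_ge0 ler01; apply => //; exact: sine_trial_deriv_norm_le1.
Qed.

Lemma integrable_sine_trial_deriv : mu.-integrable `[a, b] (EFin \o sine_trial_deriv).
Proof.
have := integrable_sine_trial_deriv_powR ltr01 => i1.
apply: le_integrable i1 => //; first by apply/measurable_EFinP; exact: measurable_sine_trial_deriv.
by move=> x _ /=; rewrite lee_fin powRr1// normr_id.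
Qed.

Let sine_trial_left x : a <= x <= m -> sine_trial x = \int[mu]_(t in `[a, x]) sine_trial_deriv t.
Proof.
move=> /andP[ax xm]; rewrite /Rintegral.
have -> : (\int[mu]_(t in `[a, x]) (sine_trial_deriv t)%:E =
   \int[mu]_(t in `[a, x]) (C (k * t + - (k * a))%R)%:E)%E.
  apply: eq_integral => t; rewrite inE/= in_itv/= => /andP[_ tx].
  by rewrite /sine_trial_deriv (le_trans tx xm).
rewrite integral_coss_half ?(lt0r_neq0 k0)//.
- by rewrite /= subrr [S 0]sins_half_le0// subr0 /sine_trial sins_left// mulrC.
- by apply: left_range; rewrite lexx ltW.
- by apply: left_range; rewrite ax.
Qed.

(** The derivative is bounded, so a single function is admissible for the exponents p, q and s at
    once. *)
Lemma sine_trial_W10 (r : R) : 0 < r -> W10 r a b sine_trial sine_trial_deriv.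
Proof.
move=> r0; split.
- exact: measurable_sine_trial_deriv.
- exact: integrable_sine_trial_deriv_powR.
- move=> x /andP[ax xb]; have [xm|mx] := leP x m; first by rewrite sine_trial_left// ax.
  have nk0 : - k != 0 by rewrite oppr_eq0 lt0r_neq0.
  have idx : mu.-integrable `[a, x] (EFin \o sine_trial_deriv).
    by apply: integrableS integrable_sine_trial_deriv => //; apply: subset_itvl; rewrite bnd_simp.
  (* Past the midpoint the integral is S(h)/k from the left half plus (S(k(b - x)) - S(h))/k from
     the rest. *)
  have := Rintegral_itvB idx (_ : BLeft a <= BRight m)%O (_ : BRight m <= BRight x)%O.
  rewrite !bnd_simp => /(_ (ltW am) (ltW mx)) /eqP; rewrite subr_eq => /eqP ->.
  rewrite -sine_trial_left; last by rewrite lexx ltW.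
  have -> : \int[mu]_(t in `]m, x]) sine_trial_deriv t =
      \int[mu]_(t in `]m, x]) (-1 * C (- k * t + k * b)).
    apply: eq_Rintegral => t; rewrite inE/= in_itv/= => /andP[mt _].
    by rewrite /sine_trial_deriv leNgt mt mulN1r.
  have iC : mu.-integrable `[m, x] (EFin \o (fun t => C (- k * t + k * b))).
    apply: continuous_compact_integrable; first exact: segment_compact.
    by apply: continuous_subspaceT; exact: c_affine (continuous_coss_half s1).
  have iC' : mu.-integrable `]m, x] (EFin \o (fun t => C (- k * t + k * b))).
    by apply: integrableS iC => //; apply: subset_itvr; rewrite bnd_simp.
  rewrite RintegralZl// Rintegral_itv_obnd_cbnd// /Rintegral.
  rewrite integral_coss_half ?(ltW mx)//; last 2 first.
    by apply: right_range; rewrite lexx ltW.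
    by apply: right_range; rewrite xb ltW.
  rewrite /= /sine_trial sins_right// sins_left// -mulrBr km.
  have -> : - k * m + k * b = h by rewrite mulNr addrC -mulrBr km'.
  by rewrite invrN; move: (S _) (S h) (k^-1) => A B D; ring.
- rewrite /sine_trial sins_right// mulNr addNr [S 0]sins_half_le0// mulr0//.
Qed.

Let pis_k : 2 * h / k = b - a.
Proof. by rewrite -[2 * h]/(pis s) invf_div mulrC divfK// lt0r_neq0 ?pis_gt0. Qed.

Let measurable_sins_powR : measurable_fun `[a, b] (fun x => sins s (k * (x - a)) `^ s).
Proof.
have -> : (fun x => sins s (k * (x - a)) `^ s) = (fun x => (k * sine_trial x) `^ s).
  by apply/funext => x; rewrite /sine_trial mulrA divff ?mul1r// lt0r_neq0.
apply: (measurableT_comp (@measurable_powR R s)).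
by apply: measurable_funM => //; exact: measurable_sine_trial.
Qed.

(** Stated on a general interval to serve twice: for the norm of the trial function, and with (0,
    pi_s) for the constant of the theorem. *)
Lemma integral_sins_powR :
  (\int[mu]_(x in `[a, b]) (sins s (k * (x - a)%R) `^ s)%:E = ((b - a) / s)%:E)%E.
Proof.
have sne : s != 0 by rewrite lt0r_neq0// (lt_trans ltr01 s1).
transitivity ((2 * (s^-1 * (h - SC h) - s^-1 * (0 - SC 0)) / k)%:E); last first.
- suff -> : 2 * (s^-1 * (h - SC h) - s^-1 * (0 - SC 0)) / k = (b - a) / s by [].
  rewrite SC0 SCh; transitivity (2 * h / k / s); last by rewrite pis_k.
  by move: (k^-1) => x; field.
apply: (@symmetric_integral (fun x => sins s (k * (x - a)) `^ s)
  (fun x => s^-1 * (x - SC x)) (fun x => S x `^ s)).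
- exact: measurable_sins_powR.
- by move=> x; exact: powR_ge0.
- by move=> x /andP[_ xm]; rewrite sins_left// ltW.
- by move=> x /andP[mx _]; rewrite sins_right.
- by apply: continuous_sins_half_powR => //; exact: lt_trans s1.
- move=> x; apply: cvgM; first exact: cvg_cst.
  by apply: cvgB; [exact: cvg_id|exact: continuous_SC].
- move=> z z0h.
  have := is_deriveZ s^-1 (is_deriveB (is_derive_id z (1 : R)) (dSC z0h)).
  move=> /is_derive_eq; apply; rewrite /GRing.scale/= coss_half_powR//.
  by field.
Qed.

Lemma integral_sine_trial_deriv_powR :
  (\int[mu]_(x in `[a, b]) (`|sine_trial_deriv x| `^ s)%:E = ((s - 1) * (b - a) / s)%:E)%E.
Proof.
have sne : s != 0 by rewrite lt0r_neq0// (lt_trans ltr01 s1).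
transitivity ((2 * (s^-1 * ((s - 1) * h + SC h) -
  s^-1 * ((s - 1) * 0 + SC 0)) / k)%:E); last first.
- suff -> : 2 * (s^-1 * ((s - 1) * h + SC h) - s^-1 * ((s - 1) * 0 + SC 0)) / k =
      (s - 1) * (b - a) / s by [].
  rewrite SC0 SCh; transitivity ((s - 1) * (2 * h / k) / s); last by rewrite pis_k.
  by move: (k^-1) => x; field.
apply: (@symmetric_integral (fun x => `|sine_trial_deriv x| `^ s)
  (fun x => s^-1 * ((s - 1) * x + SC x)) (fun x => C x `^ s)).
- apply: (measurableT_comp (@measurable_powR R s)).
  by apply: measurableT_comp => //; exact: measurable_sine_trial_deriv.
- by move=> x; exact: powR_ge0.
- by move=> x /andP[_ xm]; rewrite sine_trial_deriv_norm ltW.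
- by move=> x /andP[mx _]; rewrite sine_trial_deriv_norm leNgt mx.
- by apply: continuous_coss_half_powR => //; exact: lt_trans s1.
- move=> x; apply: cvgM; first exact: cvg_cst.
  apply: cvgD; last exact: continuous_SC.
  by apply: cvgM; [exact: cvg_cst|exact: cvg_id].
- move=> z z0h.
  have := is_deriveZ s^-1 (is_deriveD (is_deriveZ (s - 1) (is_derive_id z (1 : R))) (dSC z0h)).
  move=> /is_derive_eq; apply; rewrite /GRing.scale/= coss_half_powR//.
  by field.
Qed.

Lemma integral_sine_trial_powR :
  \int[mu]_(x in `[a, b]) (`|sine_trial x| `^ s) = (k `^ s)^-1 * ((b - a) / s).
Proof.
have s00 (y : R) : 0 <= sins s y.
  rewrite /sins; case: ifP => _.
    by case/andP: (sins_half01 s1 y).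
  by case/andP: (sins_half01 s1 (pis s - y)).
rewrite /Rintegral.
under eq_integral => x _.
  rewrite normrM [`|sins _ _|]ger0_norm// powRM// ger0_norm ?invr_ge0 ?(ltW k0)//.
  rewrite EFinM; over.
rewrite ge0_integralZl//=; last 3 first.
- exact/measurable_EFinP.
- by move=> x _; rewrite lee_fin powR_ge0.
- by rewrite lee_fin powR_ge0.
rewrite integral_sins_powR /=; congr (_ * _).
by rewrite -powR_inv1 ?(ltW k0)// -powRrM mulN1r powRN.
Qed.

End sharp_poincare.

(** * Comparison of the two eigenvalues *)

Section eigenvalue_comparison.
Set Implicit Arguments.
Unset Strict Implicit.
Context {R : realType}.
Notation mu := (@lebesgue_measure R).

Lemma Rintegral_sine_trial_deriv_powR_le (s a b p : R) : 1 < s -> a < b -> s <= p ->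
  \int[mu]_(x in `[a, b]) (`|sine_trial_deriv s a b x| `^ p) <= (s - 1) * (b - a) / s.
Proof.
move=> s1 ab sp; have s0 : 0 < s by exact: lt_trans s1.
have E : \int[mu]_(x in `[a, b]) (`|sine_trial_deriv s a b x| `^ s) = (s - 1) * (b - a) / s.
  by rewrite /Rintegral integral_sine_trial_deriv_powR.
rewrite -E; apply: le_Rintegral => //.
- by apply: integrable_sine_trial_deriv_powR => //; exact: lt_le_trans sp.
- exact: integrable_sine_trial_deriv_powR.
- move=> x _; have d1 := sine_trial_deriv_norm_le1 a b s1 x.
  (* Decrease of the power in the exponent is applied to a base in (0, 1]; base 0 is treated
     apart. *)
  have [->|d0] := eqVneq `|sine_trial_deriv s a b x| 0.
    by rewrite !powR0// gt_eqF// (lt_le_trans _ sp).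
  by apply: ger_powR; rewrite // d1 andbT lt_neqAle eq_sym d0 normr_ge0.
Qed.

(** With I = int |u'|^s = (s-1)(b-a)/s, Jensen gives (b-a)^(1-q/s) I^(q/s) = I ((b-a)/I)^(1-q/s),
    and (b-a)/I = s/(s-1). *)
Lemma Rintegral_sine_trial_deriv_powR_holder (s a b q : R) : 1 < s -> a < b ->
  0 < q -> q < s ->
  \int[mu]_(x in `[a, b]) (`|sine_trial_deriv s a b x| `^ q) <=
  (s - 1) * (b - a) / s * (s / (s - 1)) `^ (1 - q / s).
Proof.
move=> s1 ab q0 qs; have s0 : 0 < s by exact: lt_trans s1.
have s10 : 0 < s - 1 by rewrite subr_gt0.
have ba0 : 0 < b - a by rewrite subr_gt0.
have r1 : 1 < s / q by rewrite ltr_pdivlMr// mul1r.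
set w := Rintegral _ _ _.
have w0 : 0 <= w by apply: Rintegral_ge0 => x _; exact: powR_ge0.
have fw : (\int[mu]_(x in `[a, b]) (`|sine_trial_deriv s a b x| `^ q)%:E)%E \is a fin_num.
  by apply: integrable_fin_num => //; exact: integrable_sine_trial_deriv_powR.
have mq : measurable_fun `[a, b] (fun x => `|sine_trial_deriv s a b x| `^ q).
  apply: (measurableT_comp (@measurable_powR R q)).
  by apply: measurableT_comp => //; exact: measurable_sine_trial_deriv.
have cab : (\int[mu]_(x in `[a, b]) (cst 1 x)%:E = (b - a)%:E)%E.
  transitivity (1%:E * mu `[a, b])%E; first exact: (integral_cst mu (measurable_itv _) 1%:E).
  by rewrite lebesgue_measure_itv/= lte_fin ab mul1e.
have := @weighted_jensen _ _ R mu `[a, b] (fun x => `|sine_trial_deriv s a b x| `^ q) (cst 1)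
  (s / q) w (b - a) (measurable_itv _) mq (measurable_cst _).
move=> /(_ (fun _ _ => powR_ge0 _ _) (fun _ _ => ltr01) r1 w0 ba0 cab).
have ww : (w%:E <= \int[mu]_(x in `[a, b]) (`|sine_trial_deriv s a b x| `^ q)%:E)%E.
  by rewrite /w /Rintegral fineK.
move=> /(_ ww).
have -> : (\int[mu]_(x in `[a, b])
    ((`|sine_trial_deriv s a b x| `^ q) `^ (s / q) * cst 1 x `^ (1 - s / q))%:E =
    ((s - 1) * (b - a) / s)%:E)%E.
  rewrite -integral_sine_trial_deriv_powR//; apply: eq_integral => x _.
  by rewrite powR1 mulr1 -powRrM mulrCA divff ?mulr1// gt_eqF.
rewrite -EFinM lee_fin => H.
have X0 : 0 < (s - 1) / s by rewrite divr_gt0.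
have HX : (b - a) `^ (s / q - 1) * ((s - 1) * (b - a) / s) =
    (b - a) `^ (s / q) * ((s - 1) / s).
  rewrite -(mulr_powRB1 (ltW ba0) (lt_trans ltr01 r1)).
  by move: (_ `^ _) => A; field; rewrite gt_eqF.
have e1 : s / q * (q / s) = 1 by field; rewrite !gt_eqF.
(* The power q/s undoes the Jensen exponent s/q. *)
have : w `^ (s / q) `^ (q / s) <= ((b - a) `^ (s / q) * ((s - 1) / s)) `^ (q / s).
  rewrite -HX ge0_ler_powR ?nnegrE ?powR_ge0//; first by rewrite divr_ge0 ?ltW.
  by rewrite mulr_ge0 ?powR_ge0// !mulr_ge0 ?invr_ge0 ?ltW.
rewrite powRM ?powR_ge0 ?(ltW X0)// -!powRrM e1 !powRr1 ?(ltW ba0)//.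
move=> /le_trans; apply; rewrite le_eqVlt; apply/orP; left; apply/eqP.
have -> : s / (s - 1) = ((s - 1) / s) `^ (-1) by rewrite powR_inv1 ?(ltW X0)// invf_div.
rewrite -powRrM.
rewrite (_ : -1 * (1 - q / s) = q / s - 1); last by ring.
rewrite -(mulr_powRB1 (ltW X0) (divr_gt0 q0 s0)).
by move: (_ `^ _) => A; field; rewrite gt_eqF.
Qed.

Lemma Lambda1_ge (s a b : R) : 1 < s -> a < b ->
  (s - 1) * (pis s / (b - a)) `^ s <= Lambda1 s a b.
Proof.
move=> s1 ab; have s0 : 0 < s by exact: lt_trans s1.
have k0 : 0 < pis s / (b - a) by rewrite divr_gt0 ?pis_gt0// subr_gt0.
apply: lb_le_inf.
  (* The set must be shown nonempty, as [inf] of the empty set is 0 by convention; the trial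
     function provides an element. *)
  exists (Rintegral mu `[a, b] (fun x => `|sine_trial_deriv s a b x| `^ s)
    / Rintegral mu `[a, b] (fun x => `|sine_trial s a b x| `^ s)).
  exists (sine_trial s a b), (sine_trial_deriv s a b); split => //; first exact: sine_trial_W10.
  rewrite integral_sine_trial_powR// gt_eqF// mulr_gt0 ?invr_gt0 ?powR_gt0//.
  by rewrite divr_gt0// subr_gt0.
move=> _ [u [du [W U0 ->]]].
have U1 : 0 < \int[mu]_(x in `[a, b]) (`|u x| `^ s).
  by rewrite lt_neqAle eq_sym U0; apply: Rintegral_ge0 => x _; exact: powR_ge0.
rewrite (ler_pdivlMr _ _ U1).
exact: (sharp_poincare s1 ab W).
Qed.

(** The interval (0, pi_s) has scaling factor k = 1. *)
Lemma Rintegral_sins_powR (s : R) : 1 < s ->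
  \int[mu]_(t in `[0, pis s]) (sins s t `^ s) = pis s / s.
Proof.
move=> s1; have p0 := pis_gt0 s1.
have E := integral_sins_powR s1 p0; rewrite subr0 in E.
have -> : \int[mu]_(t in `[0, pis s]) (sins s t `^ s) =
    fine (\int[mu]_(x in `[0%R, pis s]) (sins s (pis s / pis s * (x - 0)%R) `^ s)%:E)%E.
  by apply: eq_Rintegral => x _; rewrite subr0 divff ?mul1r// gt_eqF.
by rewrite E.
Qed.

Lemma lambda1_le (p q alpha beta a b : R) (u du : R -> R) :
  0 < p -> 0 < q -> 0 < alpha -> 0 < beta ->
  W10 p a b u du -> W10 q a b u du ->
  0 < \int[mu]_(x in `[a, b]) (`|u x| `^ (alpha + beta)) ->
  lambda1 p q alpha beta a b <=
  (p^-1 * \int[mu]_(x in `[a, b]) (`|du x| `^ p)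
    + q^-1 * \int[mu]_(x in `[a, b]) (`|du x| `^ q)) /
  \int[mu]_(x in `[a, b]) (`|u x| `^ (alpha + beta)).
Proof.
move=> p0 q0 al0 be0 Wp Wq.
have -> : \int[mu]_(x in `[a, b]) (`|u x| `^ (alpha + beta)) =
    \int[mu]_(x in `[a, b]) (`|u x| `^ alpha * `|u x| `^ beta).
  by apply: eq_Rintegral => x _; rewrite powRD// gt_eqF ?addr_gt0.
move=> U0; apply: ge_inf; last by exists u, du, u, du.
(* All admissible quotients are nonnegative, so the infimum is over a set bounded below. *)
exists 0 => _ [v [dv [w [dw [_ _ I0 ->]]]]].
apply: divr_ge0; last exact: ltW.
by rewrite addr_ge0// mulr_ge0 ?invr_ge0 ?(ltW p0) ?(ltW q0)//;
  apply: Rintegral_ge0 => x _; exact: powR_ge0.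
Qed.

End eigenvalue_comparison.

Theorem theorem1p3 (R : realType) (p q alpha beta a b : R) :
  1 < q -> q < p -> 0 < alpha -> 0 < beta ->
  alpha / p + beta / q = 1 -> a < b ->
  let s := alpha + beta in
  lambda1 p q alpha beta a b <=
    Lambda1 s a b *
      (p^-1 + q^-1 *
        (pis s / ((s - 1) *
           Rintegral (@lebesgue_measure R) `[0, pis s] (fun t => sins s t `^ s)))
          `^ (1 - q / s)).
Proof.
move=> q1 qp al0 be0 e ab; cbv zeta; set s := alpha + beta.
have q0 : 0 < q by exact: lt_trans q1.
have p0 : 0 < p by exact: lt_trans qp.
(* Replacing p by the smaller q in alpha/p + beta/q = 1 gives s/q > 1; the bound s < p is dual. *)
have qs : q < s.
  have : alpha / p < alpha / q by rewrite ltr_pM2l// ltf_pV2 ?posrE.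
  rewrite -(ltrD2r (beta / q)) e -mulrDl ltr_pdivlMr// mul1r.
  by [].
have sp : s < p.
  have : beta / p < beta / q by rewrite ltr_pM2l// ltf_pV2 ?posrE.
  rewrite -(ltrD2l (alpha / p)) e -mulrDl ltr_pdivrMr// mul1r.
  by [].
have s1 : 1 < s by exact: lt_trans qs.
have s0 : 0 < s by exact: lt_trans s1.
have s10 : 0 < s - 1 by rewrite subr_gt0.
have ba0 : 0 < b - a by rewrite subr_gt0.
have pi0 := pis_gt0 s1.
have k0 : 0 < pis s / (b - a) by rewrite divr_gt0.
have -> : pis s / ((s - 1) * Rintegral (@lebesgue_measure R) `[0, pis s]
    (fun t => sins s t `^ s)) = s / (s - 1).
  rewrite Rintegral_sins_powR//.
  by field; rewrite !gt_eqF.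
set X := (s / (s - 1)) `^ _.
have X0 : 0 <= X by exact: powR_ge0.
(* The two eigenvalues are compared through (s-1) k^s, which is at most [Lambda1]. *)
apply: (@le_trans _ _ ((s - 1) * (pis s / (b - a)) `^ s * (p^-1 + q^-1 * X))); last first.
  apply: ler_wpM2r; last exact: Lambda1_ge.
  by rewrite addr_ge0 ?mulr_ge0 ?invr_ge0 ?(ltW p0) ?(ltW q0).
have UE := integral_sine_trial_powR s1 ab.
have U0 : 0 < ((pis s / (b - a)) `^ s)^-1 * ((b - a) / s).
  by rewrite mulr_gt0 ?invr_gt0 ?powR_gt0// divr_gt0.
have := @lambda1_le R p q alpha beta a b (sine_trial s a b) (sine_trial_deriv s a b) p0 q0 al0 be0
  (sine_trial_W10 s1 ab p0) (sine_trial_W10 s1 ab q0).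
rewrite -/s UE => /(_ U0) /le_trans; apply.
rewrite ler_pdivrMr//.
have -> : (s - 1) * (pis s / (b - a)) `^ s * (p^-1 + q^-1 * X) *
    (((pis s / (b - a)) `^ s)^-1 * ((b - a) / s)) =
    p^-1 * ((s - 1) * (b - a) / s) + q^-1 * ((s - 1) * (b - a) / s * X).
  have k1 : (pis s / (b - a)) `^ s != 0 by rewrite gt_eqF// powR_gt0.
  move: (_ `^ s) k1 => A A0.
  by field; rewrite A0 ?gt_eqF.
apply: lerD; (apply: ler_wpM2l; first by rewrite invr_ge0 ltW).
- by apply: Rintegral_sine_trial_deriv_powR_le => //; exact: ltW.
- exact: Rintegral_sine_trial_deriv_powR_holder.
Qed.
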